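(* Suppose $|R(s,a)|\le U_R$ for all $(s,a)\in\mathcal S\times\mathcal A$, and that $\pi_\theta$ is differentiable in $\theta$ with score function $\nabla\log\pi_\theta(a\mid s)$ that exists and satisfies, for all $(s,a)$ and all $\theta,\theta^1,\theta^2\in\mathbb R^d$, $\|\nabla\log\pi_{\theta^1}(a\mid s)-\nabla\log\pi_{\theta^2}(a\mid s)\|\le L_\Theta\|\theta^1-\theta^2\|$ and $\|\nabla\log\pi_\theta(a\mid s)\|\le B_\Theta$. Let $\{\theta_k\}_{k\ge0}$ be the sequence of policy parameters generated by the random-horizon policy gradient (RPG) algorithm with stepsizes $\alpha_k=k^{-a}$ for $k\ge1$ (and $\alpha_0>0$ a fixed constant), where $a\in(0,1)$. Let $$K_\epsilon=\min\Big\{k:\ \inf_{0\le m\le k}\mathbb E\|\nabla J(\theta_m)\|^2\le\epsilon\Big\}.$$ Then $K_\epsilon\le O(\epsilon^{-1/p})$, where $p=\min\{1-a,a\}$. Optimizing this complexity bound over $a$ gives $K_\epsilon\le O(\epsilon^{-2})$, with $a=1/2$.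
   Context: A Markov decision process $(\mathcal S,\mathcal A,\mathbb P,R,\gamma)$ has state space $\mathcal S$ and action space $\mathcal A$ (each a finite set or a compact subset of a real vector space), transition kernel $\mathbb P(s'\mid s,a)$, deterministic reward $R:\mathcal S\times\mathcal A\to\mathbb R$ and discount factor $\gamma\in(0,1)$. For a policy $\pi$, $V_\pi(s)=\mathbb E[\sum_{t\ge0}\gamma^tR(s_t,a_t)\mid s_0=s]$ with $a_t\sim\pi(\cdot\mid s_t)$, $s_{t+1}\sim\mathbb P(\cdot\mid s_t,a_t)$. Policies are parameterized as $\pi_\theta$, $\theta\in\mathbb R^d$; the initial state $s_0$ is fixed and $J(\theta)=V_{\pi_\theta}(s_0)$. $\nabla$ is the gradient in $\theta$, $\mathbb E$ the full expectation. $O(\cdot)$ is with respect to $\epsilon\to0$, with the MDP and parameterization fixed. $\mathrm{Geom}(1-q)$ denotes the law $P(T=t)=(1-q)q^t$, $t=0,1,2,\dots$. RPG algorithm: start from a given $\theta_0$. At iteration $k\ge0$, draw $T_{k+1}\sim\mathrm{Geom}(1-\gamma)$ and simulate a trajectory from $s_0$ under $\pi_{\theta_k}$ up to time $T_{k+1}$, with last pair $(s_{T_{k+1}},a_{T_{k+1}})$. Then compute $\hat Q_{\pi_{\theta_k}}(s_{T_{k+1}},a_{T_{k+1}})$, where for a pair $(s,a)$, $\hat Q_{\pi_\theta}(s,a)=\sum_{t=0}^{T'}\gamma^{t/2}R(s_t,a_t)$ along a fresh trajectory under $\pi_\theta$ started at $s_0=s,a_0=a$, with independent $T'\sim\mathrm{Geom}(1-\gamma^{1/2})$.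 Update $$\theta_{k+1}=\theta_k+\frac{\alpha_k}{1-\gamma}\,\hat Q_{\pi_{\theta_k}}(s_{T_{k+1}},a_{T_{k+1}})\,\nabla\log\pi_{\theta_k}(a_{T_{k+1}}\mid s_{T_{k+1}}).$$ All random draws are independent across iterations given the current iterate. *)

(* Defs.v *)
From HB Require Import structures.
From mathcomp Require Import all_boot all_order all_algebra.
From mathcomp Require Import all_classical all_reals all_analysis.

Set Implicit Arguments.
Unset Strict Implicit.
Unset Printing Implicit Defensive.

Import Order.TTheory GRing.Theory Num.Theory.
Import numFieldNormedType.Exports.

Local Open Scope classical_set_scope.
Local Open Scope ring_scope.

(* The library's norm on 'rV[R]_n is the sup norm, hence this definition of the
   Euclidean norm. *)
Definition l2norm (R : realType) (n : nat) (v : 'rV[R]_n) : R :=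
  Num.sqrt (\sum_(i < n) v 0 i ^+ 2).

Definition gradient (R : realType) (n : nat) (f : 'rV[R]_n -> R)
    (x : 'rV[R]_n) : 'rV[R]_n :=
  \row_(i < n) 'D_(delta_mx 0 i) f x.

(* A finite set with the discrete sigma-algebra, or a compact subset (the range
   of the injection f) of a real topological vector space with its Borel
   sigma-algebra. *)
Definition finite_or_compact (R : realType) (d : measure_display)
    (T : measurableType d) : Prop :=
  (finite_set [set: T] /\ forall B : set T, measurable B)
  \/ exists (V : topologicalLmodType R) (f : T -> V),
       [/\ injective f, compact (range f) &
           (measurable : set (set T)) = preimage_set_system setT f <<s open >>].

Record mdp (R : realType) (dS dA : measure_display)
    (S : measurableType dS) (A : measurableType dA) := Mdp {
  states_ok : finite_or_compact R S ;
  actions_ok : finite_or_compact R A ;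
  transition : R.-pker (S * A) ~> S ;
  reward : {mfun (S * A)%type >-> R} ;
  discount : R ;
  discount01 : 0 < discount < 1 }.

(* A policy is given by its density p s a = pi(a | s) with respect to a
   reference measure nu on the actions: counting measure for a mass function on
   a finite set, e.g. Lebesgue measure on a compact set. *)
Section policies.
Context (R : realType) (dS dA : measure_display)
  (S : measurableType dS) (A : measurableType dA)
  (nu : {sigma_finite_measure set A -> \bar R}).

Definition is_policy (p : S -> A -> R) : Prop :=
  [/\ forall s a, 0 <= p s a,
      measurable_fun [set: S * A] (fun x => p x.1 x.2) &
      forall s, (\int[nu]_a (p s a)%:E = 1)%E].

Definition policy_law (p : S -> A -> R) (s : S) (B : set A) : \bar R :=
  (\int[nu]_(a in B) (p s a)%:E)%E.

Definition score (n : nat) (pi_ : 'rV[R]_n -> S -> A -> R)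
    (theta : 'rV[R]_n) (s : S) (a : A) : 'rV[R]_n :=
  gradient (fun th => ln (pi_ th s a)) theta.

End policies.

(* P(T = t) = (1 - q) q ^ t for t = 0, 1, 2, ... *)
Definition geometric_law (R : realType) (q : R) (B : set nat) : \bar R :=
  (\esum_(t in B) ((1 - q) * q ^+ t)%:E)%E.

Section sampling.
Context (R : realType) (dO : measure_display) (Omega : measurableType dO)
  (P : probability Omega R).

Definition events_of (d : measure_display) (T : measurableType d)
    (X : Omega -> T) : set_system Omega :=
  preimage_set_system setT X measurable.

(* The conditional law of X given the sigma-algebra generated by past is the
   random law kappa. *)
Definition drawn (past : set_system Omega) (d : measure_display)
    (T : measurableType d) (X : {RV P >-> T})
    (kappa : Omega -> set T -> \bar R) : Prop :=
  forall (H : set Omega) (B : set T), <<s past >> H -> measurable B ->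
    P (H `&` X @^-1` B) = (\int[P]_(w in H) kappa w B)%E.

Context (dS dA : measure_display)
  (S : measurableType dS) (A : measurableType dA)
  (nu : {sigma_finite_measure set A -> \bar R}) (M : mdp R S A).

Definition trajectory_events (s : nat -> {RV P >-> S}) (a : nat -> {RV P >-> A})
    (t : nat) : set_system Omega :=
  \bigcup_(j in [set j | (j < t)%N]) (events_of (s j) `|` events_of (a j)).

(* The policy p may be random: it is meant to be determined by past. *)
Definition state_step (past : set_system Omega)
    (s : nat -> {RV P >-> S}) (a : nat -> {RV P >-> A}) (t : nat) : Prop :=
  drawn (past `|` trajectory_events s a t.+1) (s t.+1)
    (fun w B => transition M (s t w, a t w) B).

Definition action_step (past : set_system Omega) (p : Omega -> S -> A -> R)
    (s : nat -> {RV P >-> S}) (a : nat -> {RV P >-> A}) (t : nat) : Prop :=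
  drawn (past `|` trajectory_events s a t `|` events_of (s t)) (a t)
    (fun w B => policy_law nu (p w) (s t w) B).

Definition trajectory_from_state (past : set_system Omega)
    (p : Omega -> S -> A -> R) (x : S)
    (s : nat -> {RV P >-> S}) (a : nat -> {RV P >-> A}) : Prop :=
  [/\ forall w, s 0%N w = x,
      forall t, action_step past p s a t &
      forall t, state_step past s a t].

Definition trajectory_from_pair (past : set_system Omega)
    (p : Omega -> S -> A -> R) (x : Omega -> S) (b : Omega -> A)
    (s : nat -> {RV P >-> S}) (a : nat -> {RV P >-> A}) : Prop :=
  [/\ forall w, s 0%N w = x w,
      forall w, a 0%N w = b w,
      forall t, action_step past p s a t.+1 &
      forall t, state_step past s a t].

End sampling.

Arguments trajectory_from_state {R dO Omega P dS dA S A}.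
Arguments trajectory_from_pair {R dO Omega P dS dA S A}.

(* v = E[sum_(t >= 0) gamma ^ t R(s_t, a_t) | s_0 = x] under the policy p. The
   law of a trajectory is determined by M, p and x, so that v does not depend on
   the probability space that carries it. *)
Definition is_value (R : realType) (dS dA : measure_display)
    (S : measurableType dS) (A : measurableType dA)
    (nu : {sigma_finite_measure set A -> \bar R}) (M : mdp R S A)
    (p : S -> A -> R) (x : S) (v : R) : Prop :=
  exists (dO : measure_display) (Omega : measurableType dO)
         (P : probability Omega R)
         (s : nat -> {RV P >-> S}) (a : nat -> {RV P >-> A}),
    trajectory_from_state nu M set0 (fun=> p) x s a
    /\ v%:E = 'E_P[fun w => limn (series (fun t =>
                      (discount M ^+ t * reward M (s t w, a t w))%R))]%E.

Section rpg.
Context (R : realType) (dO : measure_display) (Omega : measurableType dO)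
  (P : probability Omega R) (dS dA : measure_display)
  (S : measurableType dS) (A : measurableType dA).

(* The draws of iteration k: the horizon T_(k+1) and the trajectory started at
   the initial state; the horizon T' and the fresh trajectory used by the
   estimate of Q. Trajectories are drawn for all times, but the algorithm only
   reads them up to their horizon. *)
Record rpg_draws := RpgDraws {
  horizon : nat -> {RV P >-> nat} ;
  st : nat -> nat -> {RV P >-> S} ;
  act : nat -> nat -> {RV P >-> A} ;
  horizonQ : nat -> {RV P >-> nat} ;
  stQ : nat -> nat -> {RV P >-> S} ;
  actQ : nat -> nat -> {RV P >-> A} }.

Definition all_events (s : nat -> {RV P >-> S}) (a : nat -> {RV P >-> A}) :
    set_system Omega :=
  \bigcup_j (events_of (s j) `|` events_of (a j)).

Definition events_before (X : rpg_draws) (k : nat) : set_system Omega :=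
  \bigcup_(j in [set j | (j < k)%N])
    (events_of (horizon X j) `|` all_events (st X j) (act X j)
     `|` events_of (horizonQ X j) `|` all_events (stQ X j) (actQ X j)).

Context (nu : {sigma_finite_measure set A -> \bar R}) (M : mdp R S A).

Definition last_state (X : rpg_draws) (k : nat) (w : Omega) : S :=
  st X k (horizon X k w) w.

Definition last_action (X : rpg_draws) (k : nat) (w : Omega) : A :=
  act X k (horizon X k w) w.

Definition Qhat (X : rpg_draws) (k : nat) (w : Omega) : R :=
  \sum_(0 <= t < (horizonQ X k w).+1)
    discount M `^ (t%:R / 2) * reward M (stQ X k t w, actQ X k t w).

Definition is_rpg (n : nat) (pi_ : 'rV[R]_n -> S -> A -> R) (s0 : S)
    (alpha : nat -> R) (theta0 : 'rV[R]_n) (X : rpg_draws)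
    (theta : nat -> Omega -> 'rV[R]_n) : Prop :=
  (forall w, theta 0%N w = theta0) /\
  forall k : nat,
    let past0 := events_before X k in
    let past1 := past0 `|` events_of (horizon X k) in
    let past2 := past1 `|` all_events (st X k) (act X k) in
    let past3 := past2 `|` events_of (horizonQ X k) in
    let p := fun w => pi_ (theta k w) in
    [/\ drawn past0 (horizon X k) (fun=> geometric_law (discount M)),
        trajectory_from_state nu M past1 p s0 (st X k) (act X k),
        drawn past2 (horizonQ X k)
          (fun=> geometric_law (discount M `^ 2^-1)),
        trajectory_from_pair nu M past3 p
          (last_state X k) (last_action X k) (stQ X k) (actQ X k) &
        forall w, theta k.+1 w = theta k w +
          (alpha k / (1 - discount M) * Qhat X k w) *:
            score pi_ (theta k w) (last_state X k w) (last_action X k w)].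

End rpg.

Definition stepsize (R : realType) (alpha0 a : R) (k : nat) : R :=
  if k is 0%N then alpha0 else k%:R `^ (- a).

(* k = min {k : inf_(0 <= m <= k) e m <= eps} *)
Definition is_first_below (R : realType) (e : nat -> \bar R) (eps : R)
    (k : nat) : Prop :=
  let ok j := (ereal_inf [set e m | m in [set m | (m <= j)%N]] <= eps%:E)%E in
  ok k /\ forall j, ok j -> (k <= j)%N.

Definition rate_exponent (R : realType) (a : R) : R := Num.min (1 - a) a.

(* Main.v *)
Require Import Defs.
From mathcomp Require Import all_boot all_order all_algebra.
From mathcomp Require Import all_classical all_reals all_analysis.
From HB Require Import structures.
From mathcomp Require Import measurable_realfun lra ring.

Set Implicit Arguments.
Unset Strict Implicit.
Unset Printing Implicit Defensive.

Import Order.TTheory GRing.Theory Num.Theory.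
Import numFieldNormedType.Exports.

Local Open Scope classical_set_scope.
Local Open Scope ring_scope.

(* Write u = ln pi_(theta + v) - ln pi_theta. Changing the density of the actions
   from pi_theta to pi_(theta + v) multiplies it by e^u, and the score bounds give
   u = <score, v> + O(|v|^2) and u = O(|v|) uniformly. Inserted into the Bellman
   equations, which are gamma-contractions for the sup norm, this yields
     V_(theta + v) = V_theta + <G_theta, v> + O(|v|^2)
   uniformly in the state, where G_theta is the policy gradient expression; so
   G_theta is the gradient of V_theta and J is smooth.
   On the other side, P(T = t) = (1 - gamma) gamma^t and
   gamma^(t/2) P(T' >= t) = gamma^t turn the random horizons into the discounted
   sums, so that the update is alpha_k grad J(theta_k) on average; its norm is
   O(alpha_k). Hence
     alpha_k E|grad J(theta_k)|^2 <= E J(theta_(k+1)) - E J(theta_k) + C alpha_k^2,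
   which is summed over k <= m < 2k. *)

(** * Integrals of bounded functions *)

(** The iterate is random, so the policy that drives each trajectory is random too. For this reason
    every operator acts on functions of a parameter [z] as well as of states and actions, and is
    evaluated at [theta k w] afterwards; the price is joint measurability in the parameter. The
    hypotheses on the draws concern probabilities of events. Conditional expectations never appear:
    they are replaced by integrals against bounded weights that are measurable with respect to the
    past, such as horizon indicators, scores and the gradient itself. The derivative is never passed
    through the infinite discounted sum. The candidate gradient solves a Bellman equation of its
    own, so the remainder of the expansion solves one whose source is quadratic in v, and the
    contraction does the rest. The factor e^u makes the constants depend on a cap for |v|. Along the
    iteration such a cap exists, because the estimate of Q is surely bounded by a geometric series
    and the stepsizes are bounded. *)

Section bounded_integral.
Context (R : realType) (d : measure_display) (T : measurableType d)
  (m : {measure set T -> \bar R}) (m1 : m [set: T] = 1%E).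

Lemma bounded_integrable (f : T -> R) (c : R) :
  measurable_fun setT f -> (forall x, `|f x| <= c) ->
  m.-integrable setT (EFin \o f).
Proof.
move=> mf fc; apply/integrableP; split; first exact/measurable_EFinP.
apply: (@le_lt_trans _ _ (\int[m]_x (c%:E))%E).
  apply: ge0_le_integral => //.
  - by do 2 apply: measurableT_comp => //; exact/measurable_EFinP.
  - by move=> x _ /=; rewrite lee_fin.
by rewrite integral_cst//= m1 mule1 ltry.
Qed.

Lemma normr_Rintegral_le (f : T -> R) (c : R) :
  measurable_fun setT f -> (forall x, `|f x| <= c) ->
  `|\int[m]_x f x| <= c.
Proof.
move=> mf fc; have fi := bounded_integrable mf fc.
apply: (le_trans (le_normr_Rintegral _ fi)) => //.
have -> : c = \int[m]_x c by rewrite Rintegral_cst// m1 mulr1.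
apply: le_Rintegral => //.
- apply: (@bounded_integrable (fun x => `|f x|) c); first exact: measurableT_comp.
  by move=> x /=; rewrite normr_id.
- by apply: (@bounded_integrable (cst c) `|c|).
Qed.

Lemma Rintegral_lin (f g : T -> R) (c e a b : R) :
  measurable_fun setT f -> (forall x, `|f x| <= c) ->
  measurable_fun setT g -> (forall x, `|g x| <= e) ->
  \int[m]_x (a * f x + b * g x) = a * \int[m]_x f x + b * \int[m]_x g x.
Proof.
move=> mf fc mg ge.
have fi := bounded_integrable mf fc; have gi := bounded_integrable mg ge.
rewrite RintegralD//=.
- by rewrite !RintegralZl.
- apply: (@bounded_integrable _ (`|a| * c)).
    by apply: measurable_funM => //; exact: measurable_cst.
  by move=> x; rewrite normrM ler_wpM2l.
- apply: (@bounded_integrable _ (`|b| * e)).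
    by apply: measurable_funM => //; exact: measurable_cst.
  by move=> x; rewrite normrM ler_wpM2l.
Qed.

Lemma le_bounded_Rintegral (f g : T -> R) (c e : R) :
  measurable_fun setT f -> (forall x, `|f x| <= c) ->
  measurable_fun setT g -> (forall x, `|g x| <= e) ->
  (forall x, f x <= g x) -> \int[m]_x f x <= \int[m]_x g x.
Proof.
move=> mf fc mg ge fg; apply: le_Rintegral => //.
- exact: bounded_integrable fc.
- exact: bounded_integrable ge.
Qed.

Lemma EFin_bounded_Rintegral (f : T -> R) (c : R) :
  measurable_fun setT f -> (forall x, `|f x| <= c) ->
  (\int[m]_x f x)%:E = (\int[m]_x (f x)%:E)%E.
Proof.
move=> mf fc; rewrite /Rintegral fineK//.
exact: integrable_fin_num (bounded_integrable mf fc).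
Qed.

(** Dominated convergence with the constant [c] as dominating function, integrable since [m] has
    mass 1. Every exchange of a limit with an average below goes through it. *)
Lemma bounded_Rintegral_cvg (f_ : nat -> T -> R) (f : T -> R) (c : R) :
  (forall n, measurable_fun setT (f_ n)) ->
  (forall n x, `|f_ n x| <= c) ->
  (forall x, f_ n x @[n --> \oo] --> f x) ->
  (\int[m]_x f_ n x) @[n --> \oo] --> \int[m]_x f x.
Proof.
move=> mf fc ff.
have mlim : measurable_fun setT f.
  by apply: (measurable_fun_cvg mf) => x _; exact: ff.
have cf x : `|f x| <= c.
  rewrite ler_norml; apply/andP; split.
    apply: (cvgr_to_ge (ff x)).
    by apply: nearW => n; move: (fc n x); rewrite ler_norml => /andP[].
  apply: (cvgr_to_le (ff x)).
  by apply: nearW => n; move: (fc n x); rewrite ler_norml => /andP[].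
have [] := @dominated_convergence _ T R m setT measurableT
  (fun n => EFin \o f_ n) (EFin \o f) (cst c%:E).
- by move=> n; apply/measurable_EFinP.
- exact/measurable_EFinP.
- by apply/nearW => x _; apply: cvg_EFin; [exact: nearW|exact: ff].
- by apply: (@bounded_integrable (cst c) `|c|).
- by apply/nearW => x n _ /=; rewrite lee_fin.
move=> _ _ H; apply: (fine_cvg (a := \int[m]_x f x)).
by rewrite (EFin_bounded_Rintegral mlim cf).
Qed.

End bounded_integral.

(** * Kernels and densities *)

Section kernels.
Context (R : realType) (d1 d2 d3 : measure_display) (X : measurableType d1)
  (Y : measurableType d2) (W : measurableType d3).

Lemma pker_setT (k : R.-pker X ~> Y) x : k x setT = 1%E.
Proof. exact: prob_kernel. Qed.

Section pullback.
Variables (k : R.-pker X ~> Y) (phi : W -> X) (mphi : measurable_fun setT phi).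

(** The measurability proof is an argument, so that the kernel instances declared below can be
    attached to the term itself. *)
Definition kpullback of measurable_fun setT phi : W -> {measure set Y -> \bar R} :=
  fun w => k (phi w).

Let measurable_kpullback U : measurable U ->
  measurable_fun setT ((kpullback mphi) ^~ U).
Proof.
by move=> mU; apply: (measurableT_comp (measurable_kernel k U mU)) => //.
Qed.

HB.instance Definition _ :=
  isKernel.Build _ _ _ _ _ (kpullback mphi) measurable_kpullback.

Let kpullback1 w : kpullback mphi w setT = 1%E.
Proof. exact: prob_kernel. Qed.

HB.instance Definition _ :=
  Kernel_isProbability.Build _ _ _ _ _ (kpullback mphi) kpullback1.

End pullback.

Definition avg (k : X -> {measure set Y -> \bar R}) (f : X * Y -> R) (x : X) :=
  \int[k x]_y f (x, y).

Lemma measurable_avg (k : R.-pker X ~> Y) (f : X * Y -> R) :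
  measurable_fun setT f -> measurable_fun setT (avg k f).
Proof.
move=> mf; rewrite /avg /Rintegral.
apply: (@measurableT_comp _ _ _ _ _ _ (@fine R) setT
  (fun x => \int[k x]_y (f (x, y))%:E)%E) => //.
(* [measurable_kfcomp] concerns nonnegative integrands, hence the positive and negative parts. *)
rewrite [X in measurable_fun _ X](_ : _ = kfcomp k ((EFin \o f)^\+%E)
    \- kfcomp k ((EFin \o f)^\-%E))%E; last first.
  apply/funext => x; rewrite /kfcomp integralE; congr (_ - _)%E;
  by apply: eq_integral => y _; rewrite ?funeposE ?funenegE.
apply: emeasurable_funB.
- apply: (measurable_kfcomp k) => //.
  by apply: measurable_funepos; exact/measurable_EFinP.
- apply: (measurable_kfcomp k) => //.
  by apply: measurable_funeneg; exact/measurable_EFinP.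
Qed.

End kernels.

Section density.
Context (R : realType) (d1 d2 : measure_display) (X : measurableType d1)
  (A : measurableType d2) (nu : {sigma_finite_measure set A -> \bar R}).
Local Open Scope ereal_scope.

Definition is_density (p : X * A -> R) : Prop :=
  [/\ forall x, (0 <= p x)%R, measurable_fun setT p &
      forall x, \int[nu]_a (p (x, a))%:E = 1].

Variables (p : X * A -> R) (hp : is_density p).

Definition kdensity_ of is_density p := fun x (B : set A) =>
  \int[nu]_(a in B) (p (x, a))%:E.

Let mp x : measurable_fun setT (fun a => (p (x, a))%:E).
Proof.
case: hp => _ mp _; apply/measurable_EFinP.
exact: (measurableT_comp mp (measurable_pair1 x)).
Qed.

Let kdensity0 x : kdensity_ hp x set0 = 0.
Proof. by rewrite /kdensity_ integral_set0. Qed.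

Let kdensity_ge0 x B : 0 <= kdensity_ hp x B.
Proof. by apply: integral_ge0 => a _; rewrite lee_fin; case: hp. Qed.

Let kdensity_sigma_additive x : semi_sigma_additive (kdensity_ hp x).
Proof.
move=> F mF tF mUF; rewrite /kdensity_.
rewrite ge0_integral_bigcup//.
- apply: is_cvg_ereal_nneg_natsum_cond => // n _ _.
  by apply: integral_ge0 => a _; rewrite lee_fin; case: hp.
- exact: measurable_funTS.
- by move=> a _; rewrite lee_fin; case: hp.
Qed.

HB.instance Definition _ x := isMeasure.Build _ _ _ (kdensity_ hp x)
  (kdensity0 x) (kdensity_ge0 x) (@kdensity_sigma_additive x).

Definition kdensity : X -> {measure set A -> \bar R} := kdensity_ hp.

Let measurable_kdensity U : measurable U -> measurable_fun setT (kdensity ^~ U).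
Proof.
move=> mU; rewrite [X in measurable_fun _ X](_ : _ =
    (fun x => \int[nu]_a ((p (x, a))%:E * (\1_U a)%:E))); last first.
  apply/funext => x; rewrite /kdensity /= /kdensity_ integral_mkcond.
  apply: eq_integral => a _; rewrite patchE indicE.
  by case: ifPn => _; rewrite ?mule1 ?mule0.
pose f xa := ((p xa)%:E * (\1_U xa.2)%:E).
have mf : measurable_fun setT f.
  apply: emeasurable_funM; first by apply/measurable_EFinP; case: hp.
  apply/measurable_EFinP; apply: measurableT_comp => //.
apply: (@measurable_fun_fubini_tonelli_F _ _ _ _ _ _ f) => //.
by move=> xa; rewrite mule_ge0// lee_fin//; case: hp.
Qed.

HB.instance Definition _ := isKernel.Build _ _ _ _ _ kdensity measurable_kdensity.

Let kdensity1 x : kdensity x setT = 1.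
Proof. by rewrite /kdensity /= /kdensity_; case: hp. Qed.

HB.instance Definition _ := Kernel_isProbability.Build _ _ _ _ _ kdensity kdensity1.


HB.instance Definition _ x := Measure_isProbability.Build _ _ _ (kdensity_ hp x)
  (kdensity1 x).

(** The measure with density [p] is dominated by [nu], and its Radon-Nikodym derivative agrees with
    [p] almost everywhere because both have the same integral over every measurable set. The change
    of variables for the derivative then transfers to [p]. *)
Lemma ge0_integral_kdensity x (f : A -> \bar R) :
  measurable_fun setT f -> (forall a, 0 <= f a) ->
  \int[kdensity x]_a f a = \int[nu]_a (f a * (p (x, a))%:E).
Proof.
move=> mf f0.
have p0 a : 0 <= (p (x, a))%:E by rewrite lee_fin; case: hp.
have dom : kdensity_ hp x `<< nu.
  apply/null_content_dominatesP => // B mB nuB.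
  by rewrite /= /kdensity_ null_set_integral//; apply: measurable_funTS.
set g := Radon_Nikodym_SigmaFinite.f (kdensity_ hp x) nu.
have gi : nu.-integrable setT g by exact: Radon_Nikodym_SigmaFinite.f_integrable.
have gp : ae_eq nu setT g (fun a => (p (x, a))%:E).
  apply: integral_ae_eq => // E _ mE.
  by rewrite -Radon_Nikodym_SigmaFinite.f_integral.
transitivity (\int[nu]_a (f a * g a)).
  by rewrite Radon_Nikodym_SigmaFinite.change_of_variables.
apply: ae_eq_integral => //.
- by apply: emeasurable_funM => //; exact: measurable_int gi.
- exact: emeasurable_funM.
- exact: ae_eqe_mul2l.
Qed.

Lemma Rintegral_kdensity x (f : A -> R) (c : R) :
  measurable_fun setT f -> (forall a, (`|f a| <= c)%R) ->
  (\int[kdensity x]_a f a = \int[nu]_a (f a * p (x, a)))%R.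
Proof.
move=> mf fc; congr fine; rewrite integralE [RHS]integralE.
have p0 a : (0 <= p (x, a))%R by case: hp.
have mF : measurable_fun setT (EFin \o f) by exact/measurable_EFinP.
rewrite !ge0_integral_kdensity//;
  [|exact: measurable_funeneg|exact: measurable_funepos].
congr (_ - _); apply: eq_integral => a _.
(* Since [p] is nonnegative, it can be moved inside the maximum that defines the positive or
   negative part. *)
- by rewrite !funeposE /= muleC maxe_pMr ?lee_fin// mule0 -EFinM mulrC.
- by rewrite !funenegE /= muleC maxe_pMr ?lee_fin// mule0 -EFinM mulrN mulrC.
Qed.

End density.

(** * Expectations of sequentially drawn variables *)

Section graph_kernel.
Context (R : realType) (d1 d2 : measure_display) (X : measurableType d1)
  (Y : measurableType d2).

Section const.
Variable Q : probability X R.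
Definition kconst of unit : {measure set X -> \bar R} := Q.

Let measurable_kconst U : measurable U -> measurable_fun setT (kconst ^~ U).
Proof. by move=> mU; exact: measurable_cst. Qed.

HB.instance Definition _ := isKernel.Build _ _ _ _ _ kconst measurable_kconst.

Let kconst1 w : kconst w setT = 1%E.
Proof. exact: probability_setT. Qed.

HB.instance Definition _ := Kernel_isProbability.Build _ _ _ _ _ kconst kconst1.
End const.

Variable (k : R.-pker X ~> Y).

(** The law of the pair (x, y) with y drawn from [k x]. Composed with [kconst Q] it yields the joint
    law of x and y when x has law [Q]; the factor [unit] in the source is dictated by that
    composition. *)
Definition kgraph_ (x : unit * X) : set (X * Y) -> \bar R :=
  pushforward (k x.2) (pair x.2).

Let mpair (x : X) : measurable_fun setT (pair x : Y -> X * Y).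
Proof. exact: measurable_pair1. Qed.

Let kgraph0 x : kgraph_ x set0 = 0%E. Proof. exact: measure0. Qed.

Let kgraph_ge0 x A : (0 <= kgraph_ x A)%E. Proof. exact: measure_ge0. Qed.

Let kgraph_sigma_additive x : semi_sigma_additive (kgraph_ x).
Proof. exact: measure_semi_sigma_additive. Qed.

HB.instance Definition _ x := isMeasure.Build _ _ _ (kgraph_ x)
  (kgraph0 x) (kgraph_ge0 x) (@kgraph_sigma_additive x).

Definition kgraph : unit * X -> {measure set (X * Y) -> \bar R} := kgraph_.

Let measurable_kgraph U : measurable U -> measurable_fun setT (kgraph ^~ U).
Proof.
move=> mU; rewrite [X in measurable_fun _ X](_ : _ =
  (fun x => k x (xsection U x)) \o snd).
  apply: measurableT_comp => //.
  by apply: measurable_fun_xsection_finite_kernel; rewrite inE.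
by apply/funext => x; rewrite /kgraph /= /kgraph_ /pushforward /= xsectionE.
Qed.

HB.instance Definition _ := isKernel.Build _ _ _ _ _ kgraph measurable_kgraph.

Let kgraph1 w : kgraph w setT = 1%E.
Proof. by rewrite /kgraph /= /kgraph_ /pushforward preimage_setT prob_kernel. Qed.

HB.instance Definition _ := Kernel_isProbability.Build _ _ _ _ _ kgraph kgraph1.

End graph_kernel.

Section drawn_integral.
Context (R : realType) (dO d : measure_display) (Omega : measurableType dO)
  (P : probability Omega R) (T : measurableType d)
  (past : set_system Omega) (hpast : past `<=` measurable).
Local Notation G := (g_sigma_algebraType past).

Lemma measurable_past H : <<s past >> H -> measurable H.
Proof. by move: H; apply: smallest_sub => //; exact: sigma_algebra_measurable. Qed.

Lemma measurable_from_past d' (T' : measurableType d') (f : G -> T') :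
  measurable_fun setT f -> measurable_fun [set: Omega] f.
Proof. by move=> mf _ B mB; apply: measurable_past; exact: mf. Qed.

Let mid : measurable_fun setT (id : Omega -> G).
Proof. by move=> _ B mB; rewrite setTI; exact: measurable_past. Qed.

(** [P] restricted to the sigma-algebra of the past, obtained as an image under the identity map. *)
Definition past_probability of past `<=` measurable : set G -> \bar R :=
  pushforward P (id : Omega -> G).

Let past_probability0 : past_probability hpast set0 = 0%E.
Proof. exact: measure0. Qed.

Let past_probability_ge0 A : (0 <= past_probability hpast A)%E.
Proof. exact: measure_ge0. Qed.

Let past_probability_sigma_additive :
  semi_sigma_additive (past_probability hpast).
Proof. exact: measure_semi_sigma_additive. Qed.

HB.instance Definition _ := isMeasure.Build _ _ _ (past_probability hpast)
  past_probability0 past_probability_ge0 past_probability_sigma_additive.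

Let past_probabilityT : past_probability hpast setT = 1%E.
Proof. exact: probability_setT. Qed.

HB.instance Definition _ := Measure_isProbability.Build _ _ _
  (past_probability hpast) past_probabilityT.

Variables (X : {RV P >-> T}) (k : R.-pker G ~> T).
Hypothesis drawX : drawn past X (fun w => k w).

Let mgraph : measurable_fun setT (fun w : Omega => ((w : G), X w)).
Proof. by apply: measurable_fun_pair => //; exact: mid. Qed.

Let joint := pushforward P (fun w : Omega => ((w : G), X w)).

Let joint0 : joint set0 = 0%E. Proof. exact: measure0. Qed.
Let joint_ge0 A : (0 <= joint A)%E. Proof. exact: measure_ge0. Qed.
Let joint_sigma_additive : semi_sigma_additive joint.
Proof. exact: measure_semi_sigma_additive. Qed.

HB.instance Definition _ := isMeasure.Build _ _ _ joint
  joint0 joint_ge0 joint_sigma_additive.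

(* Both sides are integrals of f for measures on G * T that agree on rectangles. *)
Lemma ge0_drawn_integral (f : G * T -> \bar R) :
  measurable_fun setT f -> (forall x, (0 <= f x)%E) ->
  (\int[P]_w f ((w : G), X w) = \int[P]_w \int[k w]_y f ((w : G), y))%E.
Proof.
move=> mf f0.
pose m2 := mkcomp (kconst (past_probability hpast)) (kgraph k) tt.
have eqm A : measurable A -> joint A = m2 A.
  pose C := [set A `*` B | A in (@measurable _ G) & B in (@measurable _ T)].
  apply: (measure_unique C (fun=> setT)).
  - exact: measurable_prod_measurableType.
  - move=> _ _ [X1 mX1 [X2 mX2 <-]] [Y1 mY1 [Y2 mY2 <-]].
    exists (X1 `&` Y1); first exact: measurableI.
    by exists (X2 `&` Y2); [exact: measurableI|rewrite setXI].
  - by move=> _; exists setT => //; exists setT => //; rewrite setXTT.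
  - by apply/seteqP; split => // x _; exists 0%N.
  - move=> _ [H mH [B mB <-]].
    transitivity (P (H `&` X @^-1` B)) => //.
    rewrite drawX// /m2 /= /mkcomp /kcomp /kconst /=.
    rewrite ge0_integral_pushforward//=.
    + rewrite preimage_setT integral_mkcond; apply: eq_integral => w _.
      rewrite patchE /kgraph_ /pushforward /=; case: ifPn => wH.
        congr (k w _); apply/seteqP; split => y; last by case.
        by move=> By; split => //; exact: set_mem.
      rewrite (_ : _ @^-1` _ = set0) ?measure0//.
      by apply/seteqP; split => y // -[/= Hw _]; move: wH; rewrite notin_setE.
    + exact: (measurableT_comp (measurable_kernel (kgraph k) _ (measurableX mH mB))
        (measurable_pair1 tt)).
  - by move=> _; change (P setT < +oo)%E; rewrite probability_setT ltry.
have mF : measurable_fun setT (fun w : G => \int[k w]_y f (w, y))%E.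
  exact: (measurable_kfcomp k).
transitivity (\int[joint]_x f x)%E.
  by rewrite ge0_integral_pushforward.
rewrite (eq_measure_integral m2); last by move=> A mA _; exact: eqm.
rewrite /m2 /mkcomp integral_kcomp// /kconst.
rewrite /past_probability ge0_integral_pushforward//=.
- rewrite preimage_setT; apply: eq_integral => w _ /=.
  by rewrite ge0_integral_pushforward.
- have -> : (fun w : G => \int[kgraph_ k (tt, w)]_z f z)%E =
      (fun w : G => \int[k w]_y f (w, y))%E => //.
  by apply/funext => w; rewrite ge0_integral_pushforward.
- by move=> w _; exact: integral_ge0.
Qed.

Lemma drawn_Rintegral (f : G * T -> R) (c : R) :
  measurable_fun setT f -> (forall x, `|f x| <= c) ->
  \int[P]_w f ((w : G), X w) = \int[P]_w avg k f w.
Proof.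
move=> mf fc.
have mfw w : measurable_fun setT (fun y => f (w, y)).
  exact: (measurableT_comp mf (measurable_pair1 w)).
have mfX : measurable_fun [set: Omega] (fun w : Omega => f ((w : G), X w)).
  exact: (measurableT_comp mf mgraph).
have mavg : measurable_fun [set: Omega] (fun w : Omega => avg k f (w : G)).
  exact/measurable_from_past/measurable_avg.
have avgc w : `|avg k f w| <= c.
  by apply: normr_Rintegral_le => //; exact: prob_kernel.
have P1 : P setT = 1%E by exact: probability_setT.
have c0 : `|c| <= `|c| by [].
(* Reduction to the nonnegative case: [f + c] is nonnegative, and adding [c] changes either side by
   exactly [c] because all measures involved have mass 1. *)
have fc0 x : 0 <= f x + c by move: (fc x); rewrite ler_norml => /andP[+ _]; lra.
have shift (d' : measure_display) (U : measurableType d')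
    (m : {measure set U -> \bar R}) (g : U -> R) : m setT = 1%E ->
    measurable_fun setT g -> (forall x, `|g x| <= c) ->
    (\int[m]_x (g x + c)%:E = (\int[m]_x g x + c)%:E)%E.
  move=> m1 mg gc.
  rewrite -(@EFin_bounded_Rintegral _ _ _ m m1 (fun x => g x + c) (c + `|c|)).
  - rewrite RintegralD//; last 2 first.
    + exact: (@bounded_integrable _ _ _ m m1 g c).
    + exact: (@bounded_integrable _ _ _ m m1 (cst c) `|c|).
    by rewrite Rintegral_cst// m1 mulr1.
  - by apply: measurable_funD => //.
  - by move=> x; rewrite (le_trans (ler_normD _ _))// lerD.
suff : (\int[P]_w f ((w : G), X w) + c)%:E = (\int[P]_w avg k f w + c)%:E.
  by move=> -[] /addIr.
rewrite -!shift//.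
rewrite (@ge0_drawn_integral (fun x => (f x + c)%:E)).
- by apply: eq_integral => w _; rewrite shift//; exact: prob_kernel.
- apply/measurable_EFinP; exact: measurable_funD.
- by move=> x; rewrite lee_fin.
Qed.

End drawn_integral.

Section past_measurability.
Context (R : realType) (dO : measure_display) (Omega : measurableType dO)
  (P : probability Omega R).

Lemma measurable_past_sub (p q : set_system Omega) d (T : measurableType d)
    (f : Omega -> T) : p `<=` q ->
  measurable_fun [set: g_sigma_algebraType p] f ->
  measurable_fun [set: g_sigma_algebraType q] f.
Proof.
move=> pq mf _ B mB; have := mf measurableT B mB.
apply: smallest_sub => [|H /pq]; first exact: smallest_sigma_algebra.
exact: sub_gen_smallest.
Qed.

Lemma measurable_past_events (p : set_system Omega) d (T : measurableType d)
    (X : Omega -> T) : events_of X `<=` p ->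
  measurable_fun [set: g_sigma_algebraType p] X.
Proof.
move=> Xp _ B mB; apply: sub_gen_smallest; apply: Xp.
by exists B.
Qed.

Lemma events_of_measurable d (T : measurableType d) (X : {RV P >-> T}) :
  events_of X `<=` measurable.
Proof. by move=> _ [B mB <-]; exact: measurable_funP. Qed.

End past_measurability.

Section bounded_measurable.
Context (R : realType) (d : measure_display) (T : measurableType d).

(** The bound is an explicit parameter: it is passed along sums, products and averages, and takes
    the place of integrability conditions. *)
Definition bmeas (c : R) (f : T -> R) : Prop :=
  measurable_fun setT f /\ forall x, `|f x| <= c.

Lemma bmeas_lin (c e a b : R) f g : bmeas c f -> bmeas e g ->
  bmeas (`|a| * c + `|b| * e) (fun x => a * f x + b * g x).
Proof.
move=> [mf fc] [mg ge]; split.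
  by apply: measurable_funD; apply: measurable_funM => //; exact: measurable_cst.
move=> x; rewrite (le_trans (ler_normD _ _))// !normrM.
by apply: lerD; rewrite ler_wpM2l.
Qed.

Lemma bmeasM (c e : R) f g : bmeas c f -> bmeas e g ->
  bmeas (c * e) (fun x => f x * g x).
Proof.
move=> [mf fc] [mg ge]; split; first exact: measurable_funM.
by move=> x; rewrite normrM ler_pM.
Qed.

End bounded_measurable.

Lemma bmeas_comp (R : realType) d (T : measurableType d) d'
    (T' : measurableType d') (c : R) (f : T -> R) (h : T' -> T) :
  bmeas c f -> measurable_fun setT h -> bmeas c (f \o h).
Proof. by move=> [mf fc] mh; split; [exact: measurableT_comp|move=> x /=]. Qed.


(** * One-step averaging operators of the controlled chain *)

Section operators.
Context (R : realType) (dS dA dZ : measure_display)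
  (S : measurableType dS) (A : measurableType dA)
  (nu : {sigma_finite_measure set A -> \bar R}) (M : mdp R S A)
  (Z : measurableType dZ) (p : Z -> S -> A -> R).
Hypothesis pden : is_density nu (fun x : (Z * S) * A => p x.1.1 x.1.2 x.2).

(** The coordinate in [Z] is the policy parameter; it selects the density and is carried along
    unaveraged. One kernel thus treats all policies, and the result can be evaluated at a random
    parameter. *)
Definition avg_action (g : Z * (S * A) -> R) : Z * S -> R :=
  avg (kdensity pden) (fun x => g (x.1.1, (x.1.2, x.2))).

Definition avg_next (h : Z * S -> R) : Z * (S * A) -> R :=
  avg (kpullback (transition M) (@measurable_snd _ _ Z (S * A)%type))
    (fun x => h (x.1.1, x.2)).

Definition avg_step (g : Z * (S * A) -> R) : Z * (S * A) -> R :=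
  avg_next (avg_action g).

Let mshuffleA : measurable_fun [set: (Z * S) * A]
  (fun x => (x.1.1, (x.1.2, x.2))).
Proof.
apply: measurable_fun_pair; first exact: measurableT_comp.
by apply: measurable_fun_pair => //; exact: measurableT_comp.
Qed.

Let mshuffleS : measurable_fun [set: (Z * (S * A)) * S] (fun x => (x.1.1, x.2)).
Proof. by apply: measurable_fun_pair => //; exact: measurableT_comp. Qed.

Lemma avg_action_bmeas c g : bmeas c g -> bmeas c (avg_action g).
Proof.
move=> [mg gc]; split; first exact/measurable_avg/(measurableT_comp mg).
move=> x; apply: normr_Rintegral_le => //; first exact: prob_kernel.
exact: (measurableT_comp (measurableT_comp mg mshuffleA) (measurable_pair1 x)).
Qed.

Lemma avg_next_bmeas c h : bmeas c h -> bmeas c (avg_next h).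
Proof.
move=> [mh hc]; split; first exact/measurable_avg/(measurableT_comp mh).
move=> x; apply: normr_Rintegral_le => //; first exact: prob_kernel.
exact: (measurableT_comp (measurableT_comp mh mshuffleS) (measurable_pair1 x)).
Qed.

Lemma avg_step_bmeas c g : bmeas c g -> bmeas c (avg_step g).
Proof. by move=> /avg_action_bmeas /avg_next_bmeas. Qed.

Lemma avg_action_lin c e a b g h : bmeas c g -> bmeas e h ->
  avg_action (fun x => a * g x + b * h x) =
  (fun x => a * avg_action g x + b * avg_action h x).
Proof.
move=> [mg gc] [mh he]; apply/funext => x; rewrite /avg_action /avg.
apply: (Rintegral_lin (pker_setT (kdensity pden) x) a b
  (f := fun y => g (x.1, (x.2, y))) (g := fun y => h (x.1, (x.2, y)))
  (c := c) (e := e)) => //.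
- exact: (measurableT_comp (measurableT_comp mg mshuffleA) (measurable_pair1 x)).
- exact: (measurableT_comp (measurableT_comp mh mshuffleA) (measurable_pair1 x)).
Qed.

Lemma avg_next_lin c e a b g h : bmeas c g -> bmeas e h ->
  avg_next (fun x => a * g x + b * h x) =
  (fun x => a * avg_next g x + b * avg_next h x).
Proof.
move=> [mg gc] [mh he]; apply/funext => x; rewrite /avg_next /avg.
apply: (Rintegral_lin (pker_setT (transition M) x.2) a b
  (f := fun y => g (x.1, y)) (g := fun y => h (x.1, y))
  (c := c) (e := e)) => //.
- exact: (measurableT_comp (measurableT_comp mg mshuffleS) (measurable_pair1 x)).
- exact: (measurableT_comp (measurableT_comp mh mshuffleS) (measurable_pair1 x)).
Qed.

Lemma avg_step_lin c e a b g h : bmeas c g -> bmeas e h ->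
  avg_step (fun x => a * g x + b * h x) =
  (fun x => a * avg_step g x + b * avg_step h x).
Proof.
move=> bg bh; rewrite /avg_step (avg_action_lin a b bg bh).
by rewrite (avg_next_lin a b (avg_action_bmeas bg) (avg_action_bmeas bh)).
Qed.

End operators.

Section chain.
Context (R : realType) (dO dS dA dZ : measure_display)
  (Omega : measurableType dO) (P : probability Omega R)
  (S : measurableType dS) (A : measurableType dA)
  (nu : {sigma_finite_measure set A -> \bar R}) (M : mdp R S A)
  (Z : measurableType dZ) (p : Z -> S -> A -> R).
Hypothesis pden : is_density nu (fun x : (Z * S) * A => p x.1.1 x.1.2 x.2).
Variables (past : set_system Omega) (hpast : past `<=` measurable)
  (z : Omega -> Z).
Hypothesis mz : measurable_fun [set: g_sigma_algebraType past] z.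
Variables (s : nat -> {RV P >-> S}) (a : nat -> {RV P >-> A}).

Let past_s t := past `|` trajectory_events s a t `|` events_of (s t).
Let past_a t := past `|` trajectory_events s a t.+1.

Let mtraj t : trajectory_events s a t `<=` measurable.
Proof. by move=> H [j _ [] /events_of_measurable]. Qed.

Let past_sm t : past_s t `<=` measurable.
Proof. by move=> H [[/hpast|/mtraj]|/events_of_measurable]. Qed.

Let past_am t : past_a t `<=` measurable.
Proof. by move=> H [/hpast|/mtraj]. Qed.

(** [W] is an arbitrary bounded function of the past, so the identity amounts to a conditional
    expectation given the past. The random law of the action becomes a kernel from the sigma-algebra
    of all earlier draws by pulling [kdensity pden] back along the parameter and the current
    state. *)
Lemma action_step_integral c e (W : Omega -> R) (g : Z * (S * A) -> R) t :
  action_step nu past (p \o z) s a t ->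
  bmeas e (W : g_sigma_algebraType past -> R) -> bmeas c g ->
  \int[P]_w (W w * g (z w, (s t w, a t w))) =
  \int[P]_w (W w * avg_action pden g (z w, s t w)).
Proof.
move=> draw [mW We] [mg gc].
have sub : past `<=` past_s t by move=> H pH; left; left.
have mz' := measurable_past_sub sub mz.
have mW' := measurable_past_sub sub mW.
have ms : measurable_fun [set: g_sigma_algebraType (past_s t)] (s t).
  by apply: measurable_past_events => H; right.
have mzs : measurable_fun [set: g_sigma_algebraType (past_s t)]
    (fun w => (z w, s t w)) by exact: measurable_fun_pair.
have mf : measurable_fun [set: g_sigma_algebraType (past_s t) * A]
    (fun x => W x.1 * g (z x.1, (s t x.1, x.2))).
  apply: measurable_funM; first exact: (measurableT_comp mW').
  apply: (measurableT_comp mg); apply: measurable_fun_pair.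
    exact: (measurableT_comp mz').
  apply: measurable_fun_pair => //; exact: (measurableT_comp ms).
have := @drawn_Rintegral _ _ _ _ P _ (past_s t) (@past_sm t) (a t)
  (kpullback (kdensity pden) mzs) draw _ (e * c) mf.
move=> ->; last by move=> x; rewrite normrM ler_pM.
apply: eq_Rintegral => w _; rewrite /avg_action /avg /=.
rewrite RintegralZl//.
apply: (bounded_integrable (pker_setT (kdensity pden) (z w, s t w)) (c := c)) => //.
apply: (measurableT_comp mg).
by apply: measurable_fun_pair => //; exact: measurable_fun_pair.
Qed.

Lemma state_step_integral c e (W : Omega -> R) (h : Z * S -> R) t :
  state_step M past s a t ->
  bmeas e (W : g_sigma_algebraType past -> R) -> bmeas c h ->
  \int[P]_w (W w * h (z w, s t.+1 w)) =
  \int[P]_w (W w * avg_next M h (z w, (s t w, a t w))).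
Proof.
move=> draw [mW We] [mh hc].
have sub : past `<=` past_a t by move=> H pH; left.
have mz' := measurable_past_sub sub mz.
have mW' := measurable_past_sub sub mW.
have ms : measurable_fun [set: g_sigma_algebraType (past_a t)] (s t).
  by apply: measurable_past_events => H; right; exists t => //=; left.
have ma : measurable_fun [set: g_sigma_algebraType (past_a t)] (a t).
  by apply: measurable_past_events => H; right; exists t => //=; right.
have msa : measurable_fun [set: g_sigma_algebraType (past_a t)]
    (fun w => (s t w, a t w)) by exact: measurable_fun_pair.
have mf : measurable_fun [set: g_sigma_algebraType (past_a t) * S]
    (fun x => W x.1 * h (z x.1, x.2)).
  apply: measurable_funM; first exact: (measurableT_comp mW').
  apply: (measurableT_comp mh); apply: measurable_fun_pair => //.
  exact: (measurableT_comp mz').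
have := @drawn_Rintegral _ _ _ _ P _ (past_a t) (@past_am t) (s t.+1)
  (kpullback (transition M) msa) draw _ (e * c) mf.
move=> ->; last by move=> x; rewrite normrM ler_pM.
apply: eq_Rintegral => w _; rewrite /avg_next /avg /=.
rewrite RintegralZl//.
apply: (bounded_integrable (pker_setT (transition M) (s t w, a t w)) (c := c)) => //.
by apply: (measurableT_comp mh); exact: measurable_fun_pair.
Qed.

Let sa_step c e (W : Omega -> R) (g : Z * (S * A) -> R) t :
  action_step nu past (p \o z) s a t.+1 -> state_step M past s a t ->
  bmeas e (W : g_sigma_algebraType past -> R) -> bmeas c g ->
  \int[P]_w (W w * g (z w, (s t.+1 w, a t.+1 w))) =
  \int[P]_w (W w * avg_step M pden g (z w, (s t w, a t w))).
Proof.
move=> ac st bW bg; rewrite (action_step_integral ac bW bg).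
by rewrite (state_step_integral st bW (avg_action_bmeas pden bg)).
Qed.

(** The Markov property in operator form: integrating out the last step of the trajectory costs one
    application of [avg_step] to [g]. Only actions after time 0 are assumed to be drawn, so that
    trajectories from a state and from a pair are both covered. *)
Lemma chain_integral c e (W : Omega -> R) (g : Z * (S * A) -> R) t :
  (forall t, action_step nu past (p \o z) s a t.+1) ->
  (forall t, state_step M past s a t) ->
  bmeas e (W : g_sigma_algebraType past -> R) -> bmeas c g ->
  \int[P]_w (W w * g (z w, (s t w, a t w))) =
  \int[P]_w (W w * iter t (avg_step M pden) g (z w, (s 0%N w, a 0%N w))).
Proof.
move=> ac st bW; elim: t g => [//|t IHt] g bg.
rewrite (sa_step (ac t) (st t) bW bg) (IHt _ (avg_step_bmeas M pden bg)).
by rewrite iterSr.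
Qed.

Lemma iter_avg_step_bmeas c g t : bmeas c g -> bmeas c (iter t (avg_step M pden) g).
Proof. by move=> bg; elim: t => [//|t IHt] /=; exact: avg_step_bmeas. Qed.

Lemma trajectory_from_state_integral c e (W : Omega -> R) x
    (g : Z * (S * A) -> R) t :
  trajectory_from_state nu M past (p \o z) x s a ->
  bmeas e (W : g_sigma_algebraType past -> R) -> bmeas c g ->
  \int[P]_w (W w * g (z w, (s t w, a t w))) =
  \int[P]_w (W w * avg_action pden (iter t (avg_step M pden) g) (z w, x)).
Proof.
move=> [s0 ac st] bW bg; rewrite (chain_integral t (fun t => ac t.+1) st bW bg).
rewrite (action_step_integral (ac 0%N) bW (iter_avg_step_bmeas t bg)).
by apply: eq_Rintegral => w _; rewrite s0.
Qed.

Lemma trajectory_from_pair_integral c e (W : Omega -> R) x b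
    (g : Z * (S * A) -> R) t :
  trajectory_from_pair nu M past (p \o z) x b s a ->
  bmeas e (W : g_sigma_algebraType past -> R) -> bmeas c g ->
  \int[P]_w (W w * g (z w, (s t w, a t w))) =
  \int[P]_w (W w * iter t (avg_step M pden) g (z w, (x w, b w))).
Proof.
move=> [s0 a0 ac st] bW bg; rewrite (chain_integral t ac st bW bg).
by apply: eq_Rintegral => w _; rewrite s0 a0.
Qed.

End chain.

(** * The discounted resolvent and the value function *)

Section geometric_bounds.
Context (R : realType).

Lemma geometric_sum_le (q : R) n : 0 <= q < 1 ->
  \sum_(0 <= t < n) q ^+ t <= (1 - q)^-1.
Proof.
move=> /andP[q0 q1]; have q1' : 0 < 1 - q by lra.
rewrite -[leRHS]mul1r ler_pdivlMr// mulrC.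
have -> : (1 - q) * \sum_(0 <= t < n) q ^+ t = 1 - q ^+ n.
  elim: n => [|n IHn]; first by rewrite big_geq// mulr0 expr0 subrr.
  by rewrite big_nat_recr//= mulrDr IHn exprS; ring.
by rewrite gerBl exprn_ge0.
Qed.

Lemma series_geometric_le (u : nat -> R) (c q : R) n : 0 <= q < 1 ->
  (forall t, `|u t| <= c * q ^+ t) -> `|series u n| <= c / (1 - q).
Proof.
move=> q01 uc; have c0 : 0 <= c.
  by have := uc 0%N; rewrite expr0 mulr1; exact: le_trans.
rewrite /series /=; apply: (le_trans (ler_norm_sum _ _ _)).
apply: (le_trans (ler_sum _ (fun t _ => uc t))).
by rewrite -mulr_sumr ler_wpM2l// geometric_sum_le.
Qed.

Lemma cvg_series_geometric_le (u : nat -> R) (c q : R) : 0 <= q < 1 ->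
  (forall t, `|u t| <= c * q ^+ t) -> cvgn (series u).
Proof.
move=> /andP[q0 q1] uc; apply: normed_cvg.
apply: (@series_le_cvg _ _ (fun t => c * q ^+ t)) => //=.
- by move=> t; rewrite (le_trans _ (uc t)).
- by apply: is_cvg_geometric_series; rewrite ger0_norm.
Qed.

End geometric_bounds.

Section bounded_linear.
Context (R : realType) (d d' : measure_display) (T : measurableType d)
  (T' : Type).

(** Linearity is asked on bounded measurable functions only, since it can fail for averages of other
    functions. The type [T'] is free, so that an integral is covered too, as an operator with values
    on [unit]. *)
Definition blinear (O : (T -> R) -> T' -> R) : Prop :=
  forall c e a b f g, bmeas c f -> bmeas e g ->
    O (fun x => a * f x + b * g x) = (fun x => a * O f x + b * O g x).

Lemma bmeas_sum (I : Type) (r : seq I) (b c : I -> R) (u : I -> T -> R) :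
  (forall i, bmeas (c i) (u i)) ->
  bmeas (\sum_(i <- r) `|b i| * c i) (fun x => \sum_(i <- r) b i * u i x).
Proof.
move=> bu; elim: r => [|i r IHr].
  rewrite big_nil (_ : (fun _ => _) = cst 0).
    by split => // x; rewrite normr0.
  by apply/funext => x; rewrite big_nil.
rewrite big_cons.
rewrite [X in bmeas _ X](_ : _ =
  (fun x => b i * u i x + 1 * \sum_(j <- r) b j * u j x)); last first.
  by apply/funext => x; rewrite big_cons mul1r.
by have := bmeas_lin (b i) 1 (bu i) IHr; rewrite normr1 mul1r.
Qed.

Lemma blinear_sum O (I : Type) (r : seq I) (b c : I -> R) (u : I -> T -> R) :
  blinear O -> (forall i, bmeas (c i) (u i)) ->
  O (fun x => \sum_(i <- r) b i * u i x) =
  (fun x => \sum_(i <- r) b i * O (u i) x).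
Proof.
move=> lO bu; elim: r => [|i r IHr].
  rewrite (_ : (fun _ => _) = (fun x => 0 * 0 + 0 * 0)); last first.
    by apply/funext => x; rewrite big_nil mul0r addr0.
  have b0 : bmeas 0 (fun _ : T => 0 : R) by split => // x; rewrite normr0.
  rewrite (lO _ _ 0 0 _ _ b0 b0).
  by apply/funext => x; rewrite big_nil !mul0r addr0.
rewrite (_ : (fun _ => _) =
  (fun x => b i * u i x + 1 * \sum_(j <- r) b j * u j x)); last first.
  by apply/funext => x; rewrite big_cons mul1r.
rewrite (lO _ _ _ _ _ _ (bu i) (bmeas_sum r b bu)) IHr.
by apply/funext => x; rewrite big_cons mul1r.
Qed.

End bounded_linear.

Lemma Rintegral_blinear (R : realType) d (T : measurableType d)
    (m : {measure set T -> \bar R}) : m setT = 1%E ->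
  blinear (fun (f : T -> R) (_ : unit) => \int[m]_x f x).
Proof.
move=> m1 c e a b f g [mf fc] [mg ge]; apply/funext => _.
by rewrite (Rintegral_lin m1 a b mf fc mg ge).
Qed.

Lemma Rintegral_sum (R : realType) d (T : measurableType d)
    (m : {measure set T -> \bar R}) (I : Type) (r : seq I) (b c : I -> R)
    (u : I -> T -> R) : m setT = 1%E -> (forall i, bmeas (c i) (u i)) ->
  \int[m]_x \sum_(i <- r) b i * u i x = \sum_(i <- r) b i * \int[m]_x u i x.
Proof.
move=> m1 bu.
exact: (congr1 (@^~ tt) (blinear_sum r b (Rintegral_blinear m1) bu)).
Qed.

Section resolvent.
Context (R : realType) (dS dA dZ : measure_display)
  (S : measurableType dS) (A : measurableType dA)
  (nu : {sigma_finite_measure set A -> \bar R}) (M : mdp R S A)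
  (Z : measurableType dZ) (p : Z -> S -> A -> R).
Hypothesis pden : is_density nu (fun x : (Z * S) * A => p x.1.1 x.1.2 x.2).
Local Notation gamma := (discount M).

Let gamma01 : 0 <= gamma < 1.
Proof. by have /andP[g0 g1] := discount01 M; rewrite ltW. Qed.

Definition resolvent_sum n (g : Z * (S * A) -> R) : Z * (S * A) -> R := fun x =>
  \sum_(0 <= t < n) gamma ^+ t * iter t (avg_step M pden) g x.

(** The Neumann series for the inverse of the identity minus [gamma] times [avg_step]. Applied to
    the reward it gives the action value; applied to [score_return] further on, it gives the policy
    gradient up to the average over the first action. *)
Definition resolvent (g : Z * (S * A) -> R) : Z * (S * A) -> R := fun x =>
  limn (series (fun t => gamma ^+ t * iter t (avg_step M pden) g x)).

Section bounded.
Variables (c : R) (g : Z * (S * A) -> R).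
Hypothesis bg : bmeas c g.

Lemma term_le t x : `|gamma ^+ t * iter t (avg_step M pden) g x| <= c * gamma ^+ t.
Proof.
have [_ gc] := iter_avg_step_bmeas M pden t bg.
have /andP[g0 _] := gamma01.
by rewrite mulrC normrM (ger0_norm (exprn_ge0 t g0)) ler_wpM2r// exprn_ge0.
Qed.

Lemma resolvent_sum_bmeas n : bmeas (c / (1 - gamma)) (resolvent_sum n g).
Proof.
split; last by move=> x; apply: (series_geometric_le n gamma01) => t; exact: term_le.
have [] // := bmeas_sum (index_iota 0 n) (fun t => gamma ^+ t)
  (c := fun=> c) (u := fun t => iter t (avg_step M pden) g).
by move=> t; exact: iter_avg_step_bmeas.
Qed.

Lemma resolvent_sum_cvg x : resolvent_sum n g x @[n --> \oo] --> resolvent g x.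
Proof.
by apply: (cvg_series_geometric_le gamma01) => t; exact: term_le.
Qed.

Lemma resolvent_bmeas : bmeas (c / (1 - gamma)) (resolvent g).
Proof.
split.
  apply: (@measurable_fun_cvg _ _ _ _ (fun n => resolvent_sum n g)) => [n|x _].
    by have [] := resolvent_sum_bmeas n.
  exact: resolvent_sum_cvg.
move=> x; rewrite ler_norml; apply/andP; split.
  apply: (cvgr_to_ge (@resolvent_sum_cvg x)); apply: nearW => n.
  by have [_ /(_ x)] := resolvent_sum_bmeas n; rewrite ler_norml => /andP[].
apply: (cvgr_to_le (@resolvent_sum_cvg x)); apply: nearW => n.
by have [_ /(_ x)] := resolvent_sum_bmeas n; rewrite ler_norml => /andP[].
Qed.

Lemma avg_action_cvg e (f_ : nat -> Z * (S * A) -> R) f :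
  (forall n, bmeas e (f_ n)) ->
  (forall x, f_ n x @[n --> \oo] --> f x) ->
  forall x, avg_action pden (f_ n) x @[n --> \oo] --> avg_action pden f x.
Proof.
move=> bf ff x.
apply: (bounded_Rintegral_cvg (pker_setT (kdensity pden) x)
  (f_ := fun n y => f_ n (x.1, (x.2, y))) (c := e)) => //.
- move=> n; have [mf _] := bf n; apply: (measurableT_comp mf).
  by apply: measurable_fun_pair => //; exact: measurable_fun_pair.
- by move=> n y; have [_] := bf n.
Qed.

Lemma avg_next_cvg e (f_ : nat -> Z * S -> R) f : (forall n, bmeas e (f_ n)) ->
  (forall x, f_ n x @[n --> \oo] --> f x) ->
  forall x, avg_next M (f_ n) x @[n --> \oo] --> avg_next M f x.
Proof.
move=> bf ff x.
apply: (bounded_Rintegral_cvg (pker_setT (transition M) x.2)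
  (f_ := fun n y => f_ n (x.1, y)) (c := e)) => //.
- move=> n; have [mf _] := bf n; apply: (measurableT_comp mf).
  exact: measurable_fun_pair.
- by move=> n y; have [_] := bf n.
Qed.

Lemma resolvent_sumS n x : resolvent_sum n.+1 g x =
  g x + gamma * avg_step M pden (resolvent_sum n g) x.
Proof.
rewrite /resolvent_sum (blinear_sum _ _ (avg_step_lin M pden)
  (fun t => iter_avg_step_bmeas M pden t bg)).
rewrite big_nat_recl//= expr0 mul1r mulr_sumr; congr (_ + _).
by apply: eq_bigr => t _; rewrite mulrA exprS.
Qed.

(** The Bellman equation, as the limit of [resolvent_sumS]. The averages pass to the limit because
    all partial sums share the bound [c / (1 - gamma)]. *)
Lemma resolventE x :
  resolvent g x = g x + gamma * avg_step M pden (resolvent g) x.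
Proof.
have lhs : resolvent_sum n.+1 g x @[n --> \oo] --> resolvent g x.
  by rewrite (cvg_shiftS (fun n => resolvent_sum n g x)); exact: resolvent_sum_cvg.
have rhs : g x + gamma * avg_step M pden (resolvent_sum n g) x @[n --> \oo] -->
    g x + gamma * avg_step M pden (resolvent g) x.
  apply: cvgD; first exact: cvg_cst.
  apply: cvgMr.
  apply: (avg_next_cvg (fun n => avg_action_bmeas pden (resolvent_sum_bmeas n))).
  exact: (avg_action_cvg resolvent_sum_bmeas resolvent_sum_cvg).
have E : (fun n => g x + gamma * avg_step M pden (resolvent_sum n g) x) =
    (fun n => resolvent_sum n.+1 g x) by apply/funext => n; rewrite resolvent_sumS.
by move: rhs; rewrite E => rhs; apply: (cvg_unique _ lhs rhs) => //.
Qed.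

Lemma avg_action_resolvent_sum n : avg_action pden (resolvent_sum n g) =
  (fun x => \sum_(0 <= t < n)
    gamma ^+ t * avg_action pden (iter t (avg_step M pden) g) x).
Proof.
by rewrite /resolvent_sum (blinear_sum _ _ (avg_action_lin pden)
  (fun t => iter_avg_step_bmeas M pden t bg)).
Qed.

Lemma avg_action_resolvent_cvg x :
  (\sum_(0 <= t < n) gamma ^+ t * avg_action pden (iter t (avg_step M pden) g) x)
    @[n --> \oo] --> avg_action pden (resolvent g) x.
Proof.
have := avg_action_cvg resolvent_sum_bmeas resolvent_sum_cvg (x := x).
rewrite [X in X @ _ --> _ -> _](_ : _ = (fun n => \sum_(0 <= t < n)
  gamma ^+ t * avg_action pden (iter t (avg_step M pden) g) x))//.
by apply/funext => n; rewrite avg_action_resolvent_sum.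
Qed.

End bounded.

Definition rewardZ (x : Z * (S * A)) : R := reward M x.2.

Lemma rewardZ_bmeas U : (forall s a, `|reward M (s, a)| <= U) -> bmeas U rewardZ.
Proof.
move=> rU; split; last by move=> [z [s a]]; exact: rU.
exact: measurableT_comp.
Qed.

(** Whatever probability space carries the trajectory, the expected reward at time t is given by
    [trajectory_from_state_integral] with empty past, constant parameter and weight 1. Dominated
    convergence then sums the series. *)
Lemma is_valueE U z x v : (forall s a, `|reward M (s, a)| <= U) ->
  is_value nu M (p z) x v -> v = avg_action pden (resolvent rewardZ) (z, x).
Proof.
move=> rU [dO [ Omega [P [s [a [traj vE]]]]]].
have br := rewardZ_bmeas rU.
have P1 : P setT = 1%E by exact: probability_setT.
pose u t w := reward M (s t w, a t w).
have bu t : bmeas U (u t).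
  split; last by move=> w; exact: rU.
  by apply: measurableT_comp => //; exact: measurable_fun_pair.
pose un n (w : Omega) := \sum_(0 <= t < n) gamma ^+ t * u t w.
have uc t w : `|gamma ^+ t * u t w| <= U * gamma ^+ t.
  have /andP[g0 _] := gamma01.
  by rewrite mulrC normrM (ger0_norm (exprn_ge0 t g0)) ler_wpM2r ?exprn_ge0//; apply rU.
have un_cvg w : un n w @[n --> \oo] --> limn (series (fun t => gamma ^+ t * u t w)).
  exact: (cvg_series_geometric_le gamma01 (fun t => uc t w)).
have mun n : measurable_fun setT (un n).
  by have [] := bmeas_sum (index_iota 0 n) (fun t => gamma ^+ t) bu.
have unc n w : `|un n w| <= U / (1 - gamma).
  exact: (series_geometric_le n gamma01 (fun t => uc t w)).
have mlim : measurable_fun setT (fun w => limn (series (fun t => gamma ^+ t * u t w))).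
  by apply: (@measurable_fun_cvg _ _ _ _ un) => // w _; exact: un_cvg.
have limc w : `|limn (series (fun t => gamma ^+ t * u t w))| <= U / (1 - gamma).
  rewrite ler_norml; apply/andP; split.
    apply: (cvgr_to_ge (un_cvg w)); apply: nearW => n.
    by move: (unc n w); rewrite ler_norml => /andP[].
  apply: (cvgr_to_le (un_cvg w)); apply: nearW => n.
  by move: (unc n w); rewrite ler_norml => /andP[].
move: vE; rewrite unlock -(EFin_bounded_Rintegral P1 mlim limc) => -[->].
apply: (cvg_unique _ (bounded_Rintegral_cvg P1 mun unc un_cvg)) => //.
have Eu t : \int[P]_w u t w = avg_action pden (iter t (avg_step M pden) rewardZ) (z, x).
  have := @trajectory_from_state_integral _ _ _ _ _ _ P _ _ nu M _ _ pden
    set0 _ (fun=> z) _ s a U 1 (fun=> 1) x rewardZ t traj _ br.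
  under eq_Rintegral do rewrite mul1r.
  move=> ->//; last by split => // w; rewrite normr1.
  under eq_Rintegral do rewrite mul1r.
  by rewrite Rintegral_cst// [X in fine X]probability_setT mulr1.
have -> : (fun n => \int[P]_w un n w) = (fun n => \sum_(0 <= t < n)
    gamma ^+ t * avg_action pden (iter t (avg_step M pden) rewardZ) (z, x)).
  apply/funext => n; rewrite /un (Rintegral_sum _ _ P1 bu).
  by apply: eq_bigr => t _; rewrite Eu.
exact: (avg_action_resolvent_cvg br).
Qed.

End resolvent.

(** * Second-order expansion of the value in the policy *)

Section exponential_bounds.
Context (R : realType).
Implicit Types u b : R.

Lemma expR_mul1B_le1 u : expR u * (1 - u) <= 1.
Proof.
have := expR_ge1Dx (- u); rewrite expRN => h.
by rewrite mulrC -ler_pdivlMr ?expR_gt0// mul1r.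
Qed.

(** For u >= 0, [expR_mul1B_le1] gives e^u - 1 <= u e^u; for u < 0, convexity gives 1 - e^u <=
    -u. *)
Lemma norm_expRB1_le u b : `|u| <= b -> `|expR u - 1| <= b * expR b.
Proof.
move=> ub; have b0 : 0 <= b by exact: le_trans ub.
have eb : 1 <= expR b by rewrite -expR0 ler_expR.
have [u0|u0] := leP 0 u.
  have eu : 1 <= expR u by rewrite -expR0 ler_expR.
  rewrite ger0_norm; last by lra.
  have := expR_mul1B_le1 u; rewrite ger0_norm// in ub.
  have : u * expR u <= b * expR b by rewrite ler_pM ?ler_expR ?expR_ge0.
  by rewrite mulrBr mulr1 (mulrC (expR u)); lra.
have eu : expR u <= 1 by rewrite -expR0 ler_expR ltW.
rewrite ler0_norm; last by lra.
have := expR_ge1Dx u; rewrite ltr0_norm// in ub.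
have : b * 1 <= b * expR b by rewrite ler_wpM2l.
by lra.
Qed.

Lemma norm_expRB1B_le u b : `|u| <= b -> `|expR u - 1 - u| <= b ^+ 2 * expR b.
Proof.
move=> ub; have b0 : 0 <= b by exact: le_trans ub.
have h := expR_ge1Dx u; rewrite ger0_norm; last by lra.
(* The inequality e^u - 1 - u <= u (e^u - 1) is [expR_mul1B_le1] rearranged; its right side is a
   product of two first-order quantities. *)
apply: (@le_trans _ _ (u * (expR u - 1))).
  by have := expR_mul1B_le1 u; rewrite !mulrBr mulr1 (mulrC u); lra.
apply: (le_trans (ler_norm _)); rewrite normrM expr2 -mulrA.
by rewrite ler_pM// norm_expRB1_le.
Qed.

End exponential_bounds.

(** The contraction principle without suprema: the last hypothesis says that [X] inherits every
    uniform bound of [D], as an average of [D] does. Each iteration improves a bound c into e + q c;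
    the a priori bound [c0] only starts the process and ends up multiplied by [q ^+ n]. *)
Lemma contraction_bound (R : realType) (T : Type) (D E X : T -> R)
    (q c0 e : R) : 0 <= q < 1 ->
  (forall x, `|D x| <= c0) -> (forall x, D x = E x + q * X x) ->
  (forall x, `|E x| <= e) ->
  (forall c, (forall x, `|D x| <= c) -> forall x, `|X x| <= c) ->
  forall x, `|D x| <= e / (1 - q).
Proof.
move=> /andP[q0 q1] Dc DE Ee DX.
have H n x : `|D x| <= e / (1 - q) + q ^+ n * c0.
  elim: n x => [|n IHn] x.
    have : 0 <= e / (1 - q).
      by rewrite divr_ge0//; [exact: le_trans (Ee x)|lra].
    by rewrite expr0 mul1r; have := Dc x; lra.
  rewrite DE (le_trans (ler_normD _ _))// normrM (ger0_norm q0).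
  have h := ler_wpM2l q0 (DX _ IHn x).
  apply: (le_trans (lerD (Ee x) h)).
  by rewrite exprS le_eqVlt; apply/orP; left; apply/eqP; field; lra.
move=> x; have h : e / (1 - q) + q ^+ n * c0 @[n --> \oo] --> e / (1 - q) + 0.
  apply: cvgD; first exact: cvg_cst.
  rewrite -(mul0r c0); apply: cvgMl; apply: cvg_expr.
  by rewrite ger0_norm.
rewrite -[leRHS]addr0; apply: (cvgr_to_ge h).
by apply: nearW => n; exact: H.
Qed.

Section value_expansion.
Context (R : realType) (dS dA dZ : measure_display)
  (S : measurableType dS) (A : measurableType dA)
  (nu : {sigma_finite_measure set A -> \bar R}) (M : mdp R S A)
  (Z : measurableType dZ) (p : Z -> S -> A -> R).
Hypothesis pden : is_density nu (fun x : (Z * S) * A => p x.1.1 x.1.2 x.2).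
Hypothesis p_gt0 : forall z s a, 0 < p z s a.
Variable U : R.
Hypothesis rU : forall s a, `|reward M (s, a)| <= U.
Local Notation gamma := (discount M).

Let gamma01 : 0 <= gamma < 1.
Proof. by have /andP[g0 g1] := discount01 M; rewrite ltW. Qed.

Definition Qfun : Z * (S * A) -> R := resolvent M pden (@rewardZ _ _ _ _ _ _ M Z).
Definition Vfun : Z * S -> R := avg_action pden Qfun.

Local Notation q := (U / (1 - gamma)).

Lemma Qfun_bmeas : bmeas q Qfun.
Proof. exact/resolvent_bmeas/rewardZ_bmeas. Qed.

Lemma Vfun_bmeas : bmeas q Vfun.
Proof. exact/avg_action_bmeas/Qfun_bmeas. Qed.

Lemma QfunE z y : Qfun (z, y) =
  reward M y + gamma * \int[transition M y]_s Vfun (z, s).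
Proof. by rewrite {1}/Qfun (resolventE M pden (rewardZ_bmeas Z rU)). Qed.

(** Unlike in [avg_action], the policy is separated from the averaged function: comparing two
    policies requires the action value of one averaged under the other. *)
Definition policy_avg z (f : S * A -> R) s : R :=
  \int[kdensity pden (z, s)]_a f (s, a).
Definition transition_avg (h : S -> R) y : R := \int[transition M y]_s h s.

Lemma policy_avg_lin z c e a b f g : bmeas c f -> bmeas e g ->
  policy_avg z (fun x => a * f x + b * g x) =
  (fun x => a * policy_avg z f x + b * policy_avg z g x).
Proof.
move=> [mf fc] [mg ge]; apply/funext => s.
apply: (@Rintegral_lin _ _ _ _ (pker_setT (kdensity pden) (z, s))
  (fun y => f (s, y)) (fun y => g (s, y)) c e a b) => //.
- exact: (measurableT_comp mf (measurable_pair1 s)).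
- exact: (measurableT_comp mg (measurable_pair1 s)).
Qed.

Lemma transition_avg_lin c e a b f g : bmeas c f -> bmeas e g ->
  transition_avg (fun x => a * f x + b * g x) =
  (fun x => a * transition_avg f x + b * transition_avg g x).
Proof.
move=> [mf fc] [mg ge]; apply/funext => s.
exact: (@Rintegral_lin _ _ _ _ (pker_setT (transition M) s) f g c e a b).
Qed.

Lemma policy_avg_le z c f : bmeas c f -> forall s, `|policy_avg z f s| <= c.
Proof.
move=> [mf fc] s.
apply: (normr_Rintegral_le (pker_setT (kdensity pden) (z, s))) => //.
exact: (measurableT_comp mf (measurable_pair1 s)).
Qed.

Lemma transition_avg_bmeas c h : bmeas c h -> bmeas c (transition_avg h).
Proof.
move=> [mh hc]; split; last first.
  by move=> y; exact: (normr_Rintegral_le (pker_setT (transition M) y)).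
apply: (@measurable_avg _ _ _ _ _ (transition M) (fun x => h x.2)).
exact: measurableT_comp.
Qed.

(** Both sides are integrals against [nu] of [f] times the density at [z'], because e^u times the
    density at [z] is the density at [z']. *)
Lemma policy_avg_change z z' (u f : S * A -> R) c b : bmeas c f -> bmeas b u ->
  (forall s a, u (s, a) = ln (p z' s a) - ln (p z s a)) ->
  policy_avg z' f = policy_avg z (fun y => f y * expR (u y)).
Proof.
move=> [mf fc] [mu ub] uE; apply/funext => s; rewrite /policy_avg.
have m1 : measurable_fun setT (pair s : A -> S * A) by exact: measurable_pair1.
rewrite (Rintegral_kdensity pden (z', s) (f := fun a => f (s, a)) (c := c)) //; last first.
  exact: (measurableT_comp mf m1).
rewrite (Rintegral_kdensity pden (z, s) (f := fun a => f (s, a) * expR (u (s, a)))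
  (c := c * expR b)).
- apply: eq_Rintegral => a _ /=; rewrite uE expRD expRN !lnK ?posrE//.
  by rewrite -mulrA divfK// gt_eqF.
- apply: measurable_funM; first exact: (measurableT_comp mf m1).
  by apply: measurableT_comp => //; exact: (measurableT_comp mu m1).
- move=> a; rewrite normrM ler_pM// (ger0_norm (expR_ge0 _)) ler_expR.
  exact: (le_trans (ler_norm _) (ub _)).
Qed.

Section pair.
Variables (z z' : Z) (u l : S * A -> R) (b e : R).
Hypotheses (bu : bmeas b u) (bl : bmeas b l) (ule : forall y, `|u y - l y| <= e).
Hypothesis uE : forall s a, u (s, a) = ln (p z' s a) - ln (p z s a).

Let q0 : 0 <= q.
Proof.
rewrite divr_ge0//; last by have /andP[_] := gamma01; lra.
exact: le_trans (rU point point).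
Qed.

Let b0 : 0 <= b.
Proof. by have [_ /(_ point)] := bu; exact: le_trans. Qed.

Let mexp : measurable_fun setT (fun y => expR (u y)).
Proof. by apply: measurableT_comp => //; have [] := bu. Qed.

Let policy_avg_diff c f : bmeas c f ->
  forall s, `|policy_avg z' f s - policy_avg z f s| <= c * (b * expR b).
Proof.
move=> bf; have [mf fc] := bf.
have bm1 : bmeas (c * (b * expR b)) (fun y => f y * (expR (u y) - 1)).
  apply: (bmeasM bf); split; first exact: measurable_funB.
  by move=> y; apply: norm_expRB1_le; have [_] := bu.
suff -> : policy_avg z' f = (fun s => 1 * policy_avg z f s +
    1 * policy_avg z (fun y => f y * (expR (u y) - 1)) s).
  by move=> s; rewrite !mul1r addrAC subrr add0r; exact: policy_avg_le.
rewrite -(policy_avg_lin z 1 1 bf bm1) (policy_avg_change bf bu uE).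
congr (policy_avg z _).
by apply/funext => y; ring.
Qed.

Let Q1 y := Qfun (z', y).
Let Q0 y := Qfun (z, y).
Let V1 s := Vfun (z', s).
Let V0 s := Vfun (z, s).
Let dV s := V1 s - V0 s.

Let bQ1 : bmeas q Q1.
Proof. exact: (bmeas_comp Qfun_bmeas (measurable_pair1 z')). Qed.
Let bQ0 : bmeas q Q0.
Proof. exact: (bmeas_comp Qfun_bmeas (measurable_pair1 z)). Qed.
Let bV1 : bmeas q V1.
Proof. exact: (bmeas_comp Vfun_bmeas (measurable_pair1 z')). Qed.
Let bV0 : bmeas q V0.
Proof. exact: (bmeas_comp Vfun_bmeas (measurable_pair1 z)). Qed.

Let dVm : measurable_fun setT dV.
Proof. by apply: measurable_funB; [case: bV1|case: bV0]. Qed.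

Let dVc : bmeas (q + q) dV.
Proof.
split=> // s; apply: (le_trans (ler_normB _ _)).
by apply: lerD; [have [_] := bV1|have [_] := bV0].
Qed.

Let dQ : (fun y => Q1 y - Q0 y) = (fun y => gamma * transition_avg dV y).
Proof.
have -> : dV = (fun s => 1 * V1 s + (- 1) * V0 s).
  by apply/funext => s; rewrite mul1r mulN1r.
rewrite (transition_avg_lin 1 (- 1) bV1 bV0); apply/funext => y.
by rewrite /Q1 /Q0 !QfunE mul1r mulN1r mulrBr opprD addrACA subrr add0r.
Qed.

(** With P and P' the averages under the two policies, P'Q1 - PQ0 = (P' - P)Q1 + P(Q1 - Q0), and
    [dQ] rewrites the last difference through [dV] itself. The first term involves the action value
    of the new policy, which leaves a mixed term for [value_expansion]. *)
Let dVE s : dV s = (policy_avg z' Q1 s - policy_avg z Q1 s) +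
  gamma * policy_avg z (transition_avg dV) s.
Proof.
have bavg := transition_avg_bmeas dVc.
have <- : policy_avg z (fun y => Q1 y - Q0 y) s =
    gamma * policy_avg z (transition_avg dV) s.
  rewrite dQ.
  have -> : (fun y => gamma * transition_avg dV y) =
      (fun y => gamma * transition_avg dV y + 0 * transition_avg dV y).
    by apply/funext => y; rewrite mul0r addr0.
  by rewrite (policy_avg_lin z _ _ bavg bavg) mul0r addr0.
have -> : (fun y => Q1 y - Q0 y) = (fun y => 1 * Q1 y + (- 1) * Q0 y).
  by apply/funext => y; rewrite mul1r mulN1r.
rewrite (policy_avg_lin z _ _ bQ1 bQ0) /dV /V1 /V0 /Vfun.
rewrite -[avg_action pden Qfun (z', s)]/(policy_avg z' Q1 s).
rewrite -[avg_action pden Qfun (z, s)]/(policy_avg z Q0 s).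
by do ![move: (policy_avg _ _ _) => ?]; ring.
Qed.

(** A first-order bound, used in [value_expansion] where it meets a second factor of order [b]. *)
Let dV_le s : `|dV s| <= q * (b * expR b) / (1 - gamma).
Proof.
apply: (contraction_bound gamma01 (proj2 dVc) dVE) => [x|c Dc x].
  exact: policy_avg_diff.
by apply: policy_avg_le; apply: transition_avg_bmeas; split.
Qed.

Variables (F : Z * (S * A) -> R) (G : Z * S -> R) (cG : R).
Hypothesis bG : bmeas cG G.
Hypothesis FE : forall y, F (z, y) = Qfun (z, y) * l y.
Hypothesis GE : forall s, G (z, s) =
  avg_action pden F (z, s) + gamma * avg_action pden (avg_next M G) (z, s).

(** Two second-order sources, divided by [1 - gamma] through the contraction. Replacing [expR u - 1]
    by [l] costs [b ^+ 2 * expR b + e] times the bound of Q; the change of policy acting on the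
    change of Q costs [b * expR b] times the bound of [dV_le]. *)
Definition expansion_cst : R :=
  (q * (b ^+ 2 * expR b + e) + q * (b * expR b) ^+ 2 / (1 - gamma)) / (1 - gamma).

(** [G] satisfies the Bellman equation with reward Q l, the linearization of the source in [dVE].
    After subtraction the remainder [dV - G0] satisfies the same equation with a second-order
    source, and [contraction_bound] applies. *)
Lemma value_expansion s : `|Vfun (z', s) - Vfun (z, s) - G (z, s)| <= expansion_cst.
Proof.
pose G0 s := G (z, s).
have bG0 : bmeas cG G0 by exact: (bmeas_comp bG (measurable_pair1 z)).
pose D s := dV s - G0 s.
have mD : measurable_fun setT D by apply: measurable_funB => //; case: bG0.
have DE x : D x = (policy_avg z' Q1 x - policy_avg z Q1 x -
      policy_avg z (fun y => Q0 y * l y) x) +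
    gamma * policy_avg z (transition_avg D) x.
  have eqD : policy_avg z (transition_avg D) =
      (fun s => 1 * policy_avg z (transition_avg dV) s +
        (- 1) * policy_avg z (transition_avg G0) s).
    have -> : D = (fun s => 1 * dV s + (- 1) * G0 s).
      by apply/funext => t; rewrite mul1r mulN1r.
    rewrite (transition_avg_lin 1 (- 1) dVc bG0).
    by rewrite (policy_avg_lin z _ _ (transition_avg_bmeas dVc)
      (transition_avg_bmeas bG0)).
  rewrite eqD /D dVE /G0 GE.
  rewrite -[avg_action pden (avg_next M G) (z, x)]/(policy_avg z (transition_avg G0) x).
  have -> : avg_action pden F (z, x) = policy_avg z (fun y => Q0 y * l y) x.
    by apply: eq_Rintegral => a _ /=; rewrite FE.
  by do ![move: (policy_avg _ _ _) => ?]; ring.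
have Dc x : `|D x| <= q + q + cG.
  apply: (le_trans (ler_normB _ _)); apply: lerD; first by have [_] := dVc.
  by have [_] := bG0.
apply: (contraction_bound gamma01 Dc DE) => [x|c Dc' x]; last first.
  by apply: policy_avg_le; apply: transition_avg_bmeas; split.
have mu : measurable_fun setT u by case: bu.
have ml : measurable_fun setT l by case: bl.
have brem : bmeas (q * (b ^+ 2 * expR b + e))
    (fun y => Q0 y * (expR (u y) - 1 - l y)).
  apply: (bmeasM bQ0); split.
    by do 2 apply: measurable_funB => //.
  move=> y; have -> : expR (u y) - 1 - l y = (expR (u y) - 1 - u y) + (u y - l y).
    by ring.
  apply: (le_trans (ler_normD _ _)); apply: lerD => //.
  by apply: norm_expRB1B_le; have [_] := bu.
have bQexp : bmeas (q * expR b) (fun y => Q0 y * expR (u y)).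
  apply: (bmeasM bQ0); split => // y; rewrite ger0_norm ?expR_ge0// ler_expR.
  by apply: (le_trans (ler_norm _)); have [_] := bu.
have bQl := bmeasM bQ0 bl.
have bdQ : bmeas (q * (b * expR b) / (1 - gamma)) (fun y => Q1 y - Q0 y).
  rewrite dQ; split.
    apply: measurable_funM => //.
    by have [] := transition_avg_bmeas dVc.
  move=> y; have /andP[g0 g1] := gamma01; rewrite normrM (ger0_norm g0).
  have [_ h] := transition_avg_bmeas (conj dVm dV_le : bmeas _ dV).
  rewrite -[leRHS]mul1r ler_pM// ltW//.
(* Q1 is split into Q0 and Q1 - Q0: the first summand is the error of linearizing the density ratio
   at fixed Q, the difference in parentheses is the mixed term. *)
have E1 : policy_avg z' Q1 x - policy_avg z Q1 x -
      policy_avg z (fun y => Q0 y * l y) x =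
    policy_avg z (fun y => Q0 y * (expR (u y) - 1 - l y)) x +
    (policy_avg z' (fun y => Q1 y - Q0 y) x - policy_avg z (fun y => Q1 y - Q0 y) x).
  have -> : (fun y => Q0 y * (expR (u y) - 1 - l y)) =
    (fun y => 1 * (1 * (Q0 y * expR (u y)) + (- 1) * Q0 y) + (- 1) * (Q0 y * l y)).
    by apply/funext => y; ring.
  rewrite (policy_avg_lin z _ _ (bmeas_lin 1 (- 1) bQexp bQ0) bQl).
  rewrite (policy_avg_lin z _ _ bQexp bQ0).
  rewrite -(policy_avg_change bQ0 bu uE).
  have -> : (fun y => Q1 y - Q0 y) = (fun y => 1 * Q1 y + (- 1) * Q0 y).
    by apply/funext => y; rewrite mul1r mulN1r.
  rewrite !(policy_avg_lin _ _ _ bQ1 bQ0).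
  by do ![move: (policy_avg _ _ _) => ?]; ring.
rewrite E1 (le_trans (ler_normD _ _))//; apply: lerD; first exact: policy_avg_le.
apply: (le_trans (policy_avg_diff bdQ x)).
by rewrite expr2 le_eqVlt; apply/orP; left; apply/eqP; ring.
Qed.

End pair.
End value_expansion.

(** * Calculus on row vectors *)

Section euclidean.
Context (R : realType) (n : nat).
Implicit Types v w : 'rV[R]_n.

Lemma l2norm_ge0 v : 0 <= l2norm v.
Proof. exact: sqrtr_ge0. Qed.

Lemma sqr_l2norm v : l2norm v ^+ 2 = \sum_(i < n) v 0 i ^+ 2.
Proof. by rewrite sqr_sqrtr// sumr_ge0// => i _; exact: sqr_ge0. Qed.

Lemma l2normZ (t : R) v : l2norm (t *: v) = `|t| * l2norm v.
Proof.
rewrite /l2norm -sqrtr_sqr -sqrtrM ?sqr_ge0// mulr_sumr.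
by congr Num.sqrt; apply: eq_bigr => i _; rewrite mxE exprMn.
Qed.

Lemma l2norm_delta (i : 'I_n) : l2norm (delta_mx 0 i : 'rV[R]_n) = 1.
Proof.
rewrite /l2norm (bigD1 i)//= mxE !eqxx expr1n big1 ?addr0 ?sqrtr1// => j ji.
by rewrite mxE (negbTE ji) andbF expr0n.
Qed.

Lemma cauchy_schwarz v w :
  `|\sum_(i < n) v 0 i * w 0 i| <= l2norm v * l2norm w.
Proof.
rewrite -(@ler_pXn2r _ 2)// ?nnegrE ?mulr_ge0 ?l2norm_ge0// real_normK ?num_real//.
rewrite exprMn !sqr_l2norm expr2 !mulr_suml -subr_ge0.
(* Lagrange's identity for the defect of the inequality. *)
rewrite [X in 0 <= X](_ : _ = 2^-1 * \sum_(i < n) \sum_(j < n)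
    (v 0 i * w 0 j - v 0 j * w 0 i) ^+ 2).
  by rewrite mulr_ge0// ?invr_ge0//; do 2 apply: sumr_ge0 => ? _; exact: sqr_ge0.
under eq_bigr do rewrite mulr_sumr.
under [X in _ - X]eq_bigr do rewrite mulr_sumr.
have E : \sum_(i < n) \sum_(j < n) v 0 i ^+ 2 * w 0 j ^+ 2 =
    \sum_(i < n) \sum_(j < n) v 0 j ^+ 2 * w 0 i ^+ 2 by exact: exchange_big.
have -> : \sum_(i < n) \sum_(j < n) (v 0 i * w 0 j - v 0 j * w 0 i) ^+ 2 =
    \sum_(i < n) \sum_(j < n) v 0 i ^+ 2 * w 0 j ^+ 2 +
    \sum_(i < n) \sum_(j < n) v 0 j ^+ 2 * w 0 i ^+ 2 -
    2 * \sum_(i < n) \sum_(j < n) v 0 i * w 0 i * (v 0 j * w 0 j).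
  rewrite mulr_sumr -big_split -sumrB; apply: eq_bigr => i _ /=.
  rewrite mulr_sumr -big_split -sumrB; apply: eq_bigr => j _ /=.
  by ring.
by rewrite -E; field.
Qed.

Lemma derive_gradient (f : 'rV[R]_n -> R) x v : differentiable f x ->
  'D_v f x = \sum_(i < n) v 0 i * gradient f x 0 i.
Proof.
move=> df; rewrite deriveE// [in LHS](row_sum_delta v) linear_sum.
by apply: eq_bigr => i _; rewrite linearZ mxE deriveE.
Qed.

Lemma mean_value_gradient (f : 'rV[R]_n -> R) x v :
  (forall y, differentiable f y) ->
  exists2 c : R, 0 < c < 1 &
    f (x + v) - f x = \sum_(i < n) v 0 i * gradient f (x + c *: v) 0 i.
Proof.
move=> df; pose phi (t : R) := f (x + t *: v).
have dphi (t : R) : is_derive t (1 : R) phi ('D_v f (x + t *: v)).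
  (* The difference quotients of [phi] at t are those of [f] at [x + t *: v] along [v], so the
     derivative transfers without a chain rule. *)
  have E : (fun h : R => h^-1 *: ((phi \o shift t) (h *: 1) - phi t)) =
      (fun h => h^-1 *: ((f \o shift (x + t *: v)) (h *: v) - f (x + t *: v))).
    apply/funext => h; rewrite /phi /= (_ : h *: (1 : R) = h).
      by rewrite scalerDl addrCA.
    exact: mulr1.
  have : derivable f (x + t *: v) v by exact: diff_derivable.
  rewrite /derivable -E => dh.
  by apply: DeriveDef => //; rewrite /derive E.
have [|c c01] := @MVT R phi (fun t => 'D_v f (x + t *: v)) 0 1 ltr01
  (fun t _ => dphi t).
  apply: derivable_within_continuous => t _.
  by have [] := dphi t.
rewrite /phi scale1r scale0r addr0 subr0 mulr1 => ->.
exists c; first by move: c01; rewrite in_itv.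
exact: derive_gradient.
Qed.

Lemma gradient_lipschitz_le (f : 'rV[R]_n -> R) B x v :
  (forall y, differentiable f y) -> (forall y, l2norm (gradient f y) <= B) ->
  `|f (x + v) - f x| <= B * l2norm v.
Proof.
move=> df gB; have [c _ ->] := mean_value_gradient x v df.
apply: (le_trans (cauchy_schwarz _ _)).
by rewrite mulrC ler_wpM2r// l2norm_ge0.
Qed.

Lemma gradient_expansion_le (f : 'rV[R]_n -> R) L x v :
  (forall y, differentiable f y) ->
  (forall y z, l2norm (gradient f y - gradient f z) <= L * l2norm (y - z)) ->
  `|f (x + v) - f x - \sum_(i < n) v 0 i * gradient f x 0 i| <=
    `|L| * l2norm v ^+ 2.
Proof.
move=> df gL; have [c /andP[c0 c1] ->] := mean_value_gradient x v df.
rewrite -sumrB.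
have -> : \sum_(i < n) (v 0 i * gradient f (x + c *: v) 0 i -
    v 0 i * gradient f x 0 i) = \sum_(i < n) v 0 i *
    (gradient f (x + c *: v) - gradient f x) 0 i.
  by apply: eq_bigr => i _; rewrite -mulrBr; congr (_ * _); rewrite !mxE.
have := cauchy_schwarz v (gradient f (x + c *: v) - gradient f x).
move=> /le_trans; apply.
have h := gL (x + c *: v) x.
rewrite addrAC subrr add0r l2normZ gtr0_norm// in h.
rewrite mulrC expr2 mulrA ler_wpM2r ?l2norm_ge0//; apply: (le_trans h).
(* No sign is assumed for [L], hence the absolute value. The factor c < 1 is dropped afterwards: the
   intermediate point yields the constant |L| where integration would yield |L| / 2. *)
apply: (@le_trans _ _ (`|L| * (c * l2norm v))).
  by rewrite ler_wpM2r ?ler_norm// mulr_ge0 ?l2norm_ge0// ltW.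
rewrite ler_wpM2l// -[leRHS]mul1r ler_wpM2r ?l2norm_ge0//.
exact: ltW.
Qed.

(** Along v = h e_i the hypothesis bounds the distance from the difference quotient to the i-th
    coordinate of [g] by C |h|. As [gradient] consists of directional derivatives along the axes,
    this suffices. *)
Lemma gradient_of_expansion (f : 'rV[R]_n -> R) (g : 'rV[R]_n) x C D : 0 < D ->
  (forall v, l2norm v <= D ->
    `|f (x + v) - f x - \sum_(i < n) v 0 i * g 0 i| <= C * l2norm v ^+ 2) ->
  gradient f x = g.
Proof.
move=> D0 H; apply/rowP => i; rewrite mxE; apply/cvg_lim => //.
have C0 : 0 <= C.
  have := H (D *: delta_mx 0 i); rewrite l2normZ l2norm_delta mulr1 gtr0_norm//.
  move=> /(_ (lexx _))/(le_trans (normr_ge0 _)).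
  by rewrite pmulr_lge0// exprn_gt0.
apply/cvgrPdist_le => e e0.
have Ce : \forall h \near (0 : R)^', C * `|h| <= e.
  have [->|Cn0] := eqVneq C 0; first by apply: nearW => h; rewrite mul0r ltW.
  have Cp : 0 < C by rewrite lt0r Cn0.
  apply: filterS (dnbhs0_le (divr_gt0 e0 Cp)) => h.
  by rewrite ler_pdivlMr// mulrC.
near=> h.
have h0 : h != 0 by near: h; exact: nbhs_dnbhs_neq.
have hD : `|h| <= D.
  by near: h; exact: dnbhs0_le.
have he : C * `|h| <= e by near: h.
have := H (h *: delta_mx 0 i); rewrite l2normZ l2norm_delta mulr1 => /(_ hD).
have -> : \sum_(j < n) (h *: delta_mx 0 i : 'rV[R]_n) 0 j * g 0 j = h * g 0 i.
  rewrite (bigD1 i)//= !mxE !eqxx mulr1 big1 ?addr0// => j ji.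
  by rewrite !mxE (negbTE ji) andbF mulr0 mul0r.
move=> Hh; rewrite /= distrC /GRing.scale /=.
have -> : h^-1 * (f (h *: delta_mx 0 i + x) - f x) - g 0 i =
    h^-1 * (f (x + h *: delta_mx 0 i) - f x - h * g 0 i).
  by rewrite [x + _]addrC; field.
rewrite normrM normfV mulrC ler_pdivrMr ?normr_gt0//.
apply: (le_trans Hh); rewrite expr2 mulrA.
by rewrite ler_wpM2r.
Unshelve. all: by end_near. Qed.

End euclidean.

(** * Measurability in the parameter *)

Section parameter_space.
Context (R : realType) (n : nat).

Definition coord_sets : set_system 'rV[R]_n :=
  [set C | exists (i : 'I_n) (B : set R),
    measurable B /\ C = (fun v : 'rV[R]_n => v 0 i) @^-1` B].

(* The library puts no sigma-algebra on row vectors. *)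
Local Notation pspace := (g_sigma_algebraType coord_sets).

Lemma measurable_coord i : measurable_fun [set: pspace] (fun v : pspace => v 0 i).
Proof.
move=> _ B mB; rewrite setTI; apply: sub_sigma_algebra.
by exists i, B.
Qed.

Lemma measurable_pspace d (T : measurableType d) (f : T -> pspace) :
  (forall i, measurable_fun setT (fun x => f x 0 i)) -> measurable_fun setT f.
Proof.
move=> mf; apply: (@measurability _ _ T pspace setT f coord_sets) => //.
move=> _ [_ [i [B [mB ->]]] <-].
by have := mf i measurableT B mB.
Qed.

(** The integer label of the cell of side 1/(m+1) that contains [v]. Integer vectors form a
    countable type, so that a union over all cells preserves measurability. *)
Definition grid (m : nat) (v : 'rV[R]_n) : 'rV[int]_n :=
  \row_i Num.floor (v 0 i * m.+1%:R).

Definition ungrid (m : nat) (k : 'rV[int]_n) : 'rV[R]_n :=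
  \row_i ((k 0 i)%:~R / m.+1%:R).

Lemma ungrid_grid_cvg v : ungrid m (grid m v) @[m --> \oo] --> v.
Proof.
apply/cvg_ballP => e e0; near=> m.
have m0 : 0 < m.+1%:R :> R by [].
split => // i j; rewrite ord1 !mxE -ball_normE /ball_ /=.
have /andP[] := floor_itv (v 0 j * m.+1%:R).
set k := Num.floor _; rewrite intrD => h1 h2.
have -> : v 0 j - k%:~R / m.+1%:R = (v 0 j * m.+1%:R - k%:~R) / m.+1%:R.
  by field; rewrite gt_eqF.
rewrite ger0_norm; last by rewrite divr_ge0// subr_ge0.
apply: (@le_lt_trans _ _ (m.+1%:R^-1)).
  by rewrite ler_pdivrMr// mulVf ?gt_eqF//; move: h2; rewrite /= mulr1z; lra.
by near: m; exact: near_infty_natSinv_lt (PosNum e0).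
Unshelve. all: by end_near. Qed.

Lemma measurable_grid_eq m k : measurable [set v : pspace | grid m v = k].
Proof.
rewrite (_ : [set _ | _] =
  \bigcap_(i : 'I_n) (fun v : pspace => v 0 i * m.+1%:R) @^-1`
    [set` `[(k 0 i)%:~R, (k 0 i + 1)%:~R[ ]).
  apply: fin_bigcap_measurable => // i _; rewrite -[X in measurable X]setTI.
  have : measurable_fun [set: pspace] (fun v : pspace => v 0 i * m.+1%:R).
    by apply: measurable_funM => //; exact: measurable_coord.
  by apply => //; exact: measurable_itv.
apply/seteqP; split => [v /= <- i _|v /= H].
  by rewrite /= in_itv /= !mxE floor_itv.
apply/rowP => i; rewrite mxE; apply: floor_def.
by have := H i I; rewrite /= in_itv.
Qed.

(* A Caratheodory function is the pointwise limit of its values at the grid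
   points, each of which is attained on a measurable set of parameters. *)
Lemma measurable_caratheodory d (Y : measurableType d) (F : 'rV[R]_n -> Y -> R) :
  (forall v, measurable_fun setT (F v)) ->
  (forall y v, {for v, continuous (fun v => F v y)}) ->
  measurable_fun [set: pspace * Y] (fun x => F x.1 x.2).
Proof.
move=> mF cF.
pose Fm m (x : pspace * Y) := F (ungrid m (grid m x.1)) x.2.
apply: (@measurable_fun_cvg _ _ _ _ Fm) => [m|x _]; last first.
  have h1 := @ungrid_grid_cvg x.1; have h2 := cF x.2 x.1.
  have h3 := cvg_comp _ _ h1 h2. exact h3.
move=> _ B mB; rewrite setTI.
rewrite (_ : _ @^-1` _ = \bigcup_(k : 'rV[int]_n)
  ([set v : pspace | grid m v = k] `*` (F (ungrid m k) @^-1` B))).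
  apply: countable_bigcupT_measurable; first exact: countableP.
  move=> k; apply: measurableX; first exact: measurable_grid_eq.
  by rewrite -[X in measurable X]setTI; exact: mF.
apply/seteqP; split => [x /= Bx|x [k _ [/= <-]]//].
by exists (grid m x.1).
Qed.

End parameter_space.

Notation pspace R n := (g_sigma_algebraType (@coord_sets R n)).

Section policy_measurability.
Context (R : realType) (n : nat) (dS dA : measure_display)
  (S : measurableType dS) (A : measurableType dA)
  (nu : {sigma_finite_measure set A -> \bar R})
  (pi_ : 'rV[R]_n -> S -> A -> R).
Hypothesis policy_pi : forall theta, is_policy nu (pi_ theta).
Hypothesis pi_differentiable : forall s a theta,
  differentiable (fun th => pi_ th s a) theta.
Hypothesis score_exists : forall s a theta, 0 < pi_ theta s a /\
  differentiable (fun th => ln (pi_ th s a)) theta.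

Lemma measurable_policy : measurable_fun [set: pspace R n * (S * A)]
  (fun x => pi_ x.1 x.2.1 x.2.2).
Proof.
apply: (@measurable_caratheodory _ _ _ _ (fun th y => pi_ th y.1 y.2)).
- by move=> th; have [] := policy_pi th.
- by move=> y v; apply: differentiable_continuous; exact: pi_differentiable.
Qed.

Lemma policy_density :
  is_density nu (fun x : (pspace R n * S) * A => pi_ x.1.1 x.1.2 x.2).
Proof.
split.
- by move=> x; have [] := policy_pi x.1.1.
- apply: (measurableT_comp measurable_policy (g := fun x : (pspace R n * S) * A =>
    (x.1.1, (x.1.2, x.2)))).
  apply: measurable_fun_pair; first exact: measurableT_comp.
  by apply: measurable_fun_pair => //; exact: measurableT_comp.
- by move=> x; have [_ _ h] := policy_pi x.1; exact: h.
Qed.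

Definition score_coord (i : 'I_n) (x : pspace R n * (S * A)) : R :=
  score pi_ x.1 x.2.1 x.2.2 0 i.

(** The score is a pointwise limit of difference quotients with increment 1/(m+1), each of them
    measurable because the log-density is jointly measurable. *)
Lemma measurable_score_coord i : measurable_fun setT (score_coord i).
Proof.
pose sh (m : nat) (v : pspace R n) : pspace R n := m.+1%:R^-1 *: delta_mx 0 i + v.
have msh m : measurable_fun [set: pspace R n] (sh m).
  apply: measurable_pspace => j.
  rewrite (_ : (fun _ => _) =
    (fun v : pspace R n => (m.+1%:R^-1 *: delta_mx 0 i : 'rV[R]_n) 0 j + v 0 j)).
    by apply: measurable_funD => //; exact: measurable_coord.
  by apply/funext => v; rewrite /sh mxE.
have mln : measurable_fun [set: pspace R n * (S * A)]
    (fun x => ln (pi_ x.1 x.2.1 x.2.2)).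
  by apply: measurableT_comp => //; exact: measurable_policy.
apply: (@measurable_fun_cvg _ _ _ _ (fun m x =>
  m.+1%:R * (ln (pi_ (sh m x.1) x.2.1 x.2.2) - ln (pi_ x.1 x.2.1 x.2.2)))).
  move=> m; apply: measurable_funM => //; apply: measurable_funB => //.
  apply: (measurableT_comp mln (g := fun x : pspace R n * (S * A) => (sh m x.1, x.2))).
  by apply: measurable_fun_pair => //; exact: measurableT_comp.
move=> [th [s a]] _.
have [_ df] := score_exists s a th.
have dv : derivable (fun th => ln (pi_ th s a)) th (delta_mx 0 i).
  exact: diff_derivable.
rewrite /score_coord /score /= mxE.
have u0 : (m.+1%:R^-1 : R) @[m --> \oo] --> (0 : R) by exact: cvg_harmonic.
have n0 (m : nat) : (m.+1%:R^-1 : R) != 0 by rewrite invr_neq0.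
apply: cvg_trans ((cvgr_dnbhsP _ _ _).1 dv _ (conj n0 u0)).
by apply: near_eq_cvg; apply: nearW => m; rewrite /= invrK.
Qed.

End policy_measurability.

(** * The policy gradient *)

Section policy_gradient.
Context (R : realType) (n : nat) (dS dA : measure_display)
  (S : measurableType dS) (A : measurableType dA)
  (nu : {sigma_finite_measure set A -> \bar R}) (M : mdp R S A)
  (pi_ : 'rV[R]_n -> S -> A -> R).
Hypothesis policy_pi : forall theta, is_policy nu (pi_ theta).
Variables (U_R L_Theta B_Theta : R).
Hypothesis reward_bounded : forall s a, `|reward M (s, a)| <= U_R.
Hypothesis pi_differentiable : forall s a theta,
  differentiable (fun th => pi_ th s a) theta.
Hypothesis score_exists : forall s a theta, 0 < pi_ theta s a /\
  differentiable (fun th => ln (pi_ th s a)) theta.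
Hypothesis score_lipschitz : forall s a theta1 theta2,
  l2norm (score pi_ theta1 s a - score pi_ theta2 s a)
    <= L_Theta * l2norm (theta1 - theta2).
Hypothesis score_bounded : forall s a theta,
  l2norm (score pi_ theta s a) <= B_Theta.

Local Notation gamma := (discount M).
Local Notation Z := (pspace R n).
Let pden := policy_density policy_pi pi_differentiable.
Local Notation Q := (Qfun M pden).
Local Notation q := (U_R / (1 - gamma)).

Let gamma01 : 0 <= gamma < 1.
Proof. by have /andP[g0 g1] := discount01 M; rewrite ltW. Qed.

Let B0 : 0 <= B_Theta.
Proof. exact: le_trans (l2norm_ge0 _) (score_bounded point point 0). Qed.

Let q0 : 0 <= q.
Proof.
rewrite divr_ge0//; last by have /andP[_] := gamma01; lra.
exact: le_trans (reward_bounded point point).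
Qed.

Lemma coord_le_l2norm (v : 'rV[R]_n) i : `|v 0 i| <= l2norm v.
Proof.
have := cauchy_schwarz v (delta_mx 0 i); rewrite l2norm_delta mulr1.
rewrite (bigD1 i)//= mxE !eqxx mulr1 big1 ?addr0// => j ji.
by rewrite mxE (negbTE ji) andbF mulr0.
Qed.

Lemma score_coord_bmeas i : bmeas B_Theta (score_coord pi_ i).
Proof.
split; first exact: (measurable_score_coord policy_pi pi_differentiable score_exists).
by move=> x; apply: (le_trans (coord_le_l2norm _ _)).
Qed.

Definition score_return i (x : Z * (S * A)) : R := Q x * score_coord pi_ i x.

Lemma score_return_bmeas i : bmeas (q * B_Theta) (score_return i).
Proof. exact: (bmeasM (Qfun_bmeas pden reward_bounded) (score_coord_bmeas i)). Qed.

(** A coordinate of the expression in the policy gradient theorem: the expected discounted sum over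
    time of the action value times the score. *)
Definition policy_grad i : Z * S -> R :=
  avg_action pden (resolvent M pden (score_return i)).

Lemma policy_grad_bmeas i : bmeas (q * B_Theta / (1 - gamma)) (policy_grad i).
Proof. exact/avg_action_bmeas/resolvent_bmeas/score_return_bmeas. Qed.

Lemma policy_gradE i : policy_grad i =
  fun x => avg_action pden (score_return i) x +
    gamma * avg_action pden (avg_next M (policy_grad i)) x.
Proof.
have bF := score_return_bmeas i.
rewrite {1}/policy_grad.
have -> : resolvent M pden (score_return i) = (fun x => 1 * score_return i x +
    gamma * avg_step M pden (resolvent M pden (score_return i)) x).
  by apply/funext => x; rewrite {1}(resolventE M pden bF) mul1r.
rewrite (avg_action_lin pden _ _ bF (avg_step_bmeas M pden (resolvent_bmeas M pden bF))).
by apply/funext => x; rewrite mul1r.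
Qed.

(** [expansion_cst] at b = B_Theta |v| and e = |L_Theta| |v|^2, with |v|^2 factored out and |v|
    replaced by its cap [D] in the exponentials. *)
Definition smooth_cst (D : R) : R :=
  (q * (B_Theta ^+ 2 * expR (B_Theta * D) + `|L_Theta|) +
   q * (B_Theta * expR (B_Theta * D)) ^+ 2 / (1 - gamma)) / (1 - gamma).

Lemma Vfun_smooth (D : R) (th v : 'rV[R]_n) s : l2norm v <= D ->
  `|Vfun M pden ((th + v : Z), s) - Vfun M pden ((th : Z), s) -
    \sum_(i < n) v 0 i * policy_grad i ((th : Z), s)| <=
  smooth_cst D * l2norm v ^+ 2.
Proof.
move=> vD.
pose u y := ln (pi_ (th + v) y.1 y.2) - ln (pi_ th y.1 y.2).
pose l y := \sum_(i < n) v 0 i * score_coord pi_ i ((th : Z), y).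
pose b := B_Theta * l2norm v; pose e := `|L_Theta| * l2norm v ^+ 2.
pose F x := \sum_(i < n) v 0 i * score_return i x.
pose G x := \sum_(i < n) v 0 i * policy_grad i x.
have df (y : S * A) w : differentiable (fun th => ln (pi_ th y.1 y.2)) w.
  by have [] := score_exists y.1 y.2 w.
have mln (w : Z) : measurable_fun setT (fun y : S * A => ln (pi_ w y.1 y.2)).
  apply: measurableT_comp => //.
  exact: (measurableT_comp (measurable_policy policy_pi pi_differentiable)
    (measurable_pair1 w)).
have bu : bmeas b u.
  split; first by apply: measurable_funB; exact: mln.
  by move=> y; apply: (gradient_lipschitz_le th v (df y)) => w; exact: score_bounded.
have bl : bmeas b l.
  split.
    have bs i : bmeas B_Theta (fun y => score_coord pi_ i ((th : Z), y)).
      exact: (bmeas_comp (score_coord_bmeas i) (measurable_pair1 (th : Z))).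
    by case: (bmeas_sum (index_enum 'I_n) (fun i => v 0 i) bs).
  move=> y; apply: (le_trans (cauchy_schwarz v (score pi_ th y.1 y.2))).
  by rewrite /b mulrC ler_wpM2r ?l2norm_ge0.
have ule y : `|u y - l y| <= e.
  by apply: (gradient_expansion_le th v (df y)) => w1 w2; exact: score_lipschitz.
have uE s' a : u (s', a) = ln (pi_ (th + v) s' a) - ln (pi_ th s' a) by [].
have bG := bmeas_sum (index_enum 'I_n) (fun i => v 0 i) policy_grad_bmeas.
have FE y : F ((th : Z), y) = Q ((th : Z), y) * l y.
  by rewrite /F /l mulr_sumr; apply: eq_bigr => i _; rewrite mulrCA.
have GE s' : G ((th : Z), s') = avg_action pden F ((th : Z), s') +
    gamma * avg_action pden (avg_next M G) ((th : Z), s').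
  rewrite /F /G (blinear_sum _ _ (avg_action_lin pden) score_return_bmeas).
  rewrite (blinear_sum _ _ (avg_next_lin M (Z := Z)) policy_grad_bmeas).
  rewrite (blinear_sum _ _ (avg_action_lin pden)
    (fun i => avg_next_bmeas M (policy_grad_bmeas i))).
  rewrite mulr_sumr -big_split; apply: eq_bigr => i _ /=.
  by rewrite [in LHS]policy_gradE mulrDr mulrCA.
have p0 (w : Z) s' a : 0 < pi_ w s' a by have [] := score_exists s' a w.
have := value_expansion p0 reward_bounded bu bl ule uE bG FE GE s.
move=> /le_trans; apply; rewrite /expansion_cst /smooth_cst.
have g1 : 0 < 1 - gamma by have /andP[_] := gamma01; lra.
have v0 := l2norm_ge0 v.
have eb : expR b <= expR (B_Theta * D) by rewrite ler_expR ler_wpM2l.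
rewrite [leRHS]mulrAC ler_pM2r ?invr_gt0// mulrDl; apply: lerD.
  rewrite -[leRHS]mulrA ler_wpM2l// [leRHS]mulrDl lerD2r /b exprMn [leRHS]mulrAC.
  by rewrite ler_wpM2l// mulr_ge0 ?sqr_ge0.
rewrite [leRHS]mulrAC ler_pM2r ?invr_gt0// -[leRHS]mulrA ler_wpM2l//.
rewrite -exprMn ler_pXn2r ?nnegrE ?mulr_ge0 ?expR_ge0// /b.
by rewrite [leRHS]mulrAC ler_wpM2l// mulr_ge0.
Qed.

Lemma gradient_Vfun (th : 'rV[R]_n) s :
  gradient (fun th : 'rV[R]_n => Vfun M pden ((th : Z), s)) th =
  \row_i policy_grad i ((th : Z), s).
Proof.
apply: (@gradient_of_expansion _ _ _ _ _ (smooth_cst 1) 1) => // v v1.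
under eq_bigr do rewrite mxE.
exact: Vfun_smooth.
Qed.

End policy_gradient.

(** * The RPG iteration *)

Lemma measurable_random_index d d' (T : measurableType d) (T' : measurableType d')
    (N : T -> nat) (f : nat -> T -> T') :
  measurable_fun setT N -> (forall t, measurable_fun setT (f t)) ->
  measurable_fun setT (fun x => f (N x) x).
Proof.
move=> mN mf _ B mB; rewrite setTI.
rewrite (_ : _ @^-1` _ = \bigcup_t (N @^-1` [set t] `&` f t @^-1` B)).
  apply: bigcupT_measurable => t; apply: measurableI.
    by rewrite -[X in measurable X]setTI; exact: mN.
  by rewrite -[X in measurable X]setTI; exact: mf.
by apply/seteqP; split => [x /= Bx|x [t _ [/= <-]]//]; exists (N x).
Qed.

Section independent_draw.
Context (R : realType) (dO d : measure_display) (Omega : measurableType dO)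
  (P : probability Omega R) (T : measurableType d)
  (past : set_system Omega) (hpast : past `<=` measurable).
Variables (N : {RV P >-> T}) (law : set T -> \bar R).
Hypothesis drawN : drawn past N (fun=> law).

Lemma drawn_cst_integral c (W : Omega -> R) B :
  measurable B -> bmeas c (W : g_sigma_algebraType past -> R) ->
  \int[P]_w (W w * \1_B (N w)) = fine (law B) * \int[P]_w W w.
Proof.
move=> mB [mW Wc].
(* [law] is given only as a set function. The hypothesis on the whole space identifies it with the
   distribution of [N] on measurable sets, which can serve as a constant kernel. *)
have lawE C : measurable C -> law C = distribution P N C.
  move=> mC; have := drawN (@measurableT _ (g_sigma_algebraType past)) mC.
  by rewrite setTI integral_cst//= [X in (_ * X)%E]probability_setT mule1 => <-.
pose k : R.-pker (g_sigma_algebraType past) ~> T :=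
  kpullback (kconst (distribution P N)) (measurable_cst tt).
have drawk : drawn past N (fun w => k w).
  move=> H C mH mC; rewrite drawN//; apply: eq_integral => w _.
  by rewrite lawE.
have m1 : measurable_fun setT (\1_B : T -> R) by exact: measurable_indic.
have b1 y : `|\1_B y : R| <= 1.
  by rewrite indicE; case: (_ \in _); rewrite ?normr1 ?normr0.
have mf : measurable_fun [set: g_sigma_algebraType past * T]
    (fun x => W x.1 * \1_B x.2).
  apply: measurable_funM; first exact: (measurableT_comp mW).
  exact: measurableT_comp.
rewrite (@drawn_Rintegral _ _ _ _ P _ past hpast N k drawk _ (c * 1) mf).
  have -> : fine (law B) = \int[distribution P N]_y (\1_B y).
    by rewrite lawE// /Rintegral integral_indic// setIT.
  rewrite mulrC -RintegralZr//; last first.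
    apply: (@bounded_integrable _ _ _ _ _ _ c) => //; first exact: probability_setT.
    exact: (measurable_from_past hpast mW).
  apply: eq_Rintegral => w _; rewrite /avg /= RintegralZl//.
  by apply: (@bounded_integrable _ _ _ _ (pker_setT k w) _ 1).
by move=> x; rewrite normrM ler_pM.
Qed.

End independent_draw.

Section geometric_draw.
Context (R : realType) (dO : measure_display) (Omega : measurableType dO)
  (P : probability Omega R) (past : set_system Omega)
  (hpast : past `<=` measurable) (q : R) (q01 : 0 < q < 1).
Variable N : {RV P >-> nat}.
Hypothesis drawN : drawn past N (fun=> geometric_law q).
Variables (c : R) (W : Omega -> R).
Hypothesis bW : bmeas c (W : g_sigma_algebraType past -> R).

Lemma geometric_eq_integral t :
  \int[P]_w (W w * (N w == t)%:R) = (1 - q) * q ^+ t * \int[P]_w W w.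
Proof.
have := drawn_cst_integral hpast drawN (B := [set t]) _ bW.
have E w : (N w == t)%:R = \1_[set t] (N w) :> R.
  rewrite indicE; congr (nat_of_bool _)%:R.
  by apply/eqP/idP => [->|]; rewrite inE.
under [in X in _ -> X]eq_Rintegral do rewrite E.
move=> ->//; congr (_ * _); rewrite /geometric_law esum_set1//.
by have /andP[q0 q1] := q01; rewrite lee_fin mulr_ge0 ?exprn_ge0 ?ltW// subr_gt0.
Qed.

(** Induction on t, removing the atom at t: q^t - (1 - q) q^t = q^(t+1). The tail is obtained
    without summing a series. *)
Lemma geometric_ge_integral t :
  \int[P]_w (W w * (t <= N w)%N%:R) = q ^+ t * \int[P]_w W w.
Proof.
have [mW Wc] := bW.
have mW' := measurable_from_past hpast mW.
have mN (p : nat -> bool) : measurable_fun [set: Omega] (fun w => (p (N w))%:R : R).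
  have mp : measurable_fun [set: nat] (fun m => (p m)%:R : R) by [].
  exact: (measurableT_comp mp (@measurable_funP _ _ _ _ setT N)).
have bWN (p : nat -> bool) : bmeas c (fun w => W w * (p (N w))%:R).
  split; first exact: measurable_funM.
  move=> w; rewrite normrM; case: (p _); first by rewrite normr1 mulr1.
  by rewrite normr0 mulr0 (le_trans _ (Wc w)).
have P1 : P setT = 1%E by exact: probability_setT.
elim: t => [|t IHt].
  by rewrite expr0 mul1r; apply: eq_Rintegral => w _; rewrite mulr1.
have : \int[P]_w (W w * (t <= N w)%N%:R) =
    \int[P]_w (W w * (t.+1 <= N w)%N%:R) + \int[P]_w (W w * (N w == t)%:R).
  have [m1 b1] := bWN (fun m => (t.+1 <= m)%N).
  have [m2 b2] := bWN (fun m => m == t).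
  have := Rintegral_lin P1 1 1 m1 b1 m2 b2; rewrite !mul1r => <-.
  apply: eq_Rintegral => w _; rewrite !mul1r -mulrDr; congr (_ * _).
  by rewrite leq_eqVlt eq_sym; case: ltngtP; rewrite ?addr0 ?add0r.
rewrite IHt geometric_eq_integral exprS => h.
have -> : \int[P]_w (W w * (t.+1 <= N w)%N%:R) =
    q ^+ t * \int[P]_w W w - (1 - q) * q ^+ t * \int[P]_w W w.
  by rewrite h addrK.
by move: (\int[P]_w W w) => I0; ring.
Qed.

End geometric_draw.

Lemma sum_pick (R : realType) (u : nat -> R) N m : (N < m)%N ->
  \sum_(0 <= t < m) (N == t)%:R * u t = u N.
Proof.
move=> Nm; rewrite big_mkord (bigD1 (Ordinal Nm))//= eqxx mul1r big1 ?addr0//.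
move=> t tN; case: eqP => [Nt|_]; last by rewrite mul0r.
by move: tN; rewrite -val_eqE /= Nt eqxx.
Qed.

Lemma sum_pick_out (R : realType) (u : nat -> R) N m : (m <= N)%N ->
  \sum_(0 <= t < m) (N == t)%:R * u t = 0.
Proof.
move=> mN; rewrite big_mkord big1// => t _.
by rewrite gtn_eqF ?mul0r// (leq_trans _ mN).
Qed.

Lemma sum_until (R : realType) (u : nat -> R) N m : (N < m)%N ->
  \sum_(0 <= t < m) (t <= N)%N%:R * u t = \sum_(0 <= t < N.+1) u t.
Proof.
move=> Nm; rewrite [RHS](big_nat_widen 0 N.+1 m)//= [RHS]big_mkcond.
by apply: eq_bigr => t _; rewrite ltnS; case: leqP; rewrite ?mul1r ?mul0r.
Qed.

(** * Mean of the update given the iterate *)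

Section rpg_expectation.
Context (R : realType) (n : nat) (dS dA dO : measure_display)
  (S : measurableType dS) (A : measurableType dA)
  (nu : {sigma_finite_measure set A -> \bar R}) (M : mdp R S A)
  (pi_ : 'rV[R]_n -> S -> A -> R).
Hypothesis policy_pi : forall theta, is_policy nu (pi_ theta).
Variables (U_R B_Theta : R).
Hypothesis reward_bounded : forall s a, `|reward M (s, a)| <= U_R.
Hypothesis pi_differentiable : forall s a theta,
  differentiable (fun th => pi_ th s a) theta.
Hypothesis score_exists : forall s a theta, 0 < pi_ theta s a /\
  differentiable (fun th => ln (pi_ th s a)) theta.
Hypothesis score_bounded : forall s a theta,
  l2norm (score pi_ theta s a) <= B_Theta.
Variables (s0 : S) (theta0 : 'rV[R]_n) (alpha : nat -> R)
  (Omega : measurableType dO) (P : probability Omega R)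
  (X : rpg_draws P S A) (theta : nat -> Omega -> 'rV[R]_n).
Hypothesis rpg : is_rpg nu M pi_ s0 alpha theta0 X theta.

Local Notation gamma := (discount M).
Local Notation Z := (pspace R n).
Let pden := policy_density policy_pi pi_differentiable.
Local Notation Q := (Qfun M pden).
Local Notation past0 k := (events_before X k).
Local Notation past1 k := (past0 k `|` events_of (horizon X k)).
Local Notation past2 k := (past1 k `|` all_events (st X k) (act X k)).
Local Notation past3 k := (past2 k `|` events_of (horizonQ X k)).

Let gamma01 : 0 < gamma < 1. Proof. exact: discount01. Qed.

Let P1 : P setT = 1%E. Proof. exact: probability_setT. Qed.

Lemma all_events_measurable (s : nat -> {RV P >-> S}) (a : nat -> {RV P >-> A}) :
  all_events s a `<=` measurable.
Proof. by move=> H [j _ [] /events_of_measurable]. Qed.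

Lemma events_before_measurable k : past0 k `<=` measurable.
Proof.
by move=> H [j _ [[[]|]|]]; do ?[exact: events_of_measurable |
  exact: all_events_measurable].
Qed.

Let past1_measurable k : past1 k `<=` measurable.
Proof. by move=> H [/events_before_measurable|/events_of_measurable]. Qed.

Let past2_measurable k : past2 k `<=` measurable.
Proof. by move=> H [/past1_measurable|/all_events_measurable]. Qed.

Let past3_measurable k : past3 k `<=` measurable.
Proof. by move=> H [/past2_measurable|/events_of_measurable]. Qed.

Lemma events_beforeS k : past0 k `<=` past0 k.+1.
Proof. by move=> H [j /= jk Hj]; exists j => //=; exact: ltnW. Qed.

Let last_pair k w := (last_state X k w, last_action X k w).

Lemma measurable_last_pair (p : set_system Omega) k :
  events_of (horizon X k) `<=` p -> all_events (st X k) (act X k) `<=` p ->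
  measurable_fun [set: g_sigma_algebraType p] (last_pair k).
Proof.
move=> hp ap.
have mN : measurable_fun [set: g_sigma_algebraType p] (horizon X k).
  exact: measurable_past_events.
apply: measurable_fun_pair.
  apply: (measurable_random_index (f := fun t (w : g_sigma_algebraType p) =>
    st X k t w) mN) => t.
  by apply: measurable_past_events => H Ht; apply: ap; exists t => //; left.
apply: (measurable_random_index (f := fun t (w : g_sigma_algebraType p) =>
  act X k t w) mN) => t.
by apply: measurable_past_events => H Ht; apply: ap; exists t => //; right.
Qed.

Lemma measurable_Qhat (p : set_system Omega) k :
  events_of (horizonQ X k) `<=` p -> all_events (stQ X k) (actQ X k) `<=` p ->
  measurable_fun [set: g_sigma_algebraType p] (Qhat M X k).
Proof.
move=> hp ap.
have mN : measurable_fun [set: g_sigma_algebraType p] (horizonQ X k).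
  exact: measurable_past_events.
apply: (measurable_random_index (f := fun m (w : g_sigma_algebraType p) =>
  \sum_(0 <= t < m.+1) gamma `^ (t%:R / 2) * reward M (stQ X k t w, actQ X k t w))
  mN) => m.
apply: measurable_sum => t; apply: measurable_funM => //.
apply: measurableT_comp => //; apply: measurable_fun_pair.
  by apply: measurable_past_events => H Ht; apply: ap; exists t => //; left.
by apply: measurable_past_events => H Ht; apply: ap; exists t => //; right.
Qed.

(** The iterate is a function of the draws of earlier iterations, by induction along the update. It
    may therefore serve as the parameter [z] of the trajectory lemmas, and bounded measurable
    functions of it as weights. *)
Lemma measurable_theta k :
  measurable_fun [set: g_sigma_algebraType (past0 k)] (theta k : Omega -> Z).
Proof.
have [th0 step] := rpg; elim: k => [|k IHk].
  rewrite (_ : theta 0%N = cst theta0); first exact: measurable_cst.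
  by apply/funext => w; rewrite th0.
have mth := measurable_past_sub (@events_beforeS k) IHk.
have [_ _ _ _ thS] := step k.
have mlast : measurable_fun [set: g_sigma_algebraType (past0 k.+1)] (last_pair k).
  by apply: measurable_last_pair => H Hk; exists k => //=; left; left; [left|right].
have mQ : measurable_fun [set: g_sigma_algebraType (past0 k.+1)] (Qhat M X k).
  by apply: measurable_Qhat => H Hk; exists k => //=; [left; right|right].
apply: measurable_pspace => i.
rewrite (_ : (fun _ => _) = (fun w => theta k w 0 i +
    alpha k / (1 - gamma) * Qhat M X k w *
    score_coord pi_ i (theta k w : Z, last_pair k w))).
  apply: measurable_funD; first exact: (measurableT_comp (measurable_coord i)).
  apply: measurable_funM; first exact: measurable_funM.
  apply: (measurableT_comp
    (measurable_score_coord policy_pi pi_differentiable score_exists i)).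
  exact: measurable_fun_pair.
by apply/funext => w; rewrite thS mxE; congr (_ + _); rewrite mxE.
Qed.

Lemma sqrt_discount01 : 0 < gamma `^ 2^-1 < 1.
Proof.
have /andP[g0 g1] := gamma01; rewrite powR_gt0//=.
have e1 : 1 `^ 2^-1 = 1 :> R by rewrite powR1.
by rewrite -[ltRHS]e1 gt0_ltr_powR// ?nnegrE ?ltW.
Qed.

Lemma powR_half t : gamma `^ (t%:R / 2) = (gamma `^ 2^-1) ^+ t.
Proof.
have /andP[g0 g1] := gamma01.
by rewrite mulrC powRrM powR_mulrn// powR_ge0.
Qed.

Lemma sqr_sqrt_discount t : (gamma `^ 2^-1) ^+ t * (gamma `^ 2^-1) ^+ t = gamma ^+ t.
Proof.
have /andP[g0 g1] := gamma01; rewrite -exprMn; congr (_ ^+ t).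
rewrite -powRD; last by rewrite gt_eqF//= implybT.
by rewrite (_ : 2^-1 + 2^-1 = 1); [rewrite powRr1// ltW|field].
Qed.

(** The sum of [U_R] times the powers of the square root of [gamma]: it bounds the estimate surely,
    whatever the horizon. *)
Definition Qhat_bound : R := U_R / (1 - gamma `^ 2^-1).

Let term_le k w t :
  `|(gamma `^ 2^-1) ^+ t * reward M (stQ X k t w, actQ X k t w)| <=
  U_R * (gamma `^ 2^-1) ^+ t.
Proof.
have /andP[g0 _] := sqrt_discount01.
rewrite normrM mulrC (ger0_norm (exprn_ge0 t (ltW g0))) ler_wpM2r//.
by rewrite exprn_ge0// ltW.
Qed.

Let sqrt_discount_ge0_lt1 : 0 <= gamma `^ 2^-1 < 1.
Proof. by have /andP[g0 ->] := sqrt_discount01; rewrite ltW. Qed.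

Lemma Qhat_le k w : `|Qhat M X k w| <= Qhat_bound.
Proof.
rewrite /Qhat; under eq_bigr do rewrite powR_half.
exact: (series_geometric_le _ sqrt_discount_ge0_lt1 (term_le k w)).
Qed.

Let mhorizon (p : nat -> bool) (N : {RV P >-> nat}) (q : set_system Omega) :
  events_of N `<=` q ->
  bmeas 1 (fun w : g_sigma_algebraType q => (p (N w))%:R : R).
Proof.
move=> Nq; split.
  have mp : measurable_fun [set: nat] (fun m => (p m)%:R : R) by [].
  exact: (measurableT_comp mp (measurable_past_events Nq)).
by move=> w; case: (p _); rewrite ?normr1 ?normr0.
Qed.

Let bmeas_past (p : set_system Omega) c (f : Omega -> R) : p `<=` measurable ->
  bmeas c (f : g_sigma_algebraType p -> R) -> bmeas c f.
Proof. by move=> pm [mf fc]; split => //; exact: (measurable_from_past pm). Qed.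

Let bmeas_sub (p q : set_system Omega) c (f : Omega -> R) : p `<=` q ->
  bmeas c (f : g_sigma_algebraType p -> R) ->
  bmeas c (f : g_sigma_algebraType q -> R).
Proof. by move=> pq [mf fc]; split => //; exact: (measurable_past_sub pq). Qed.

Let bmeas_theta d' (T : measurableType d') (p : set_system Omega) k c
    (F : Z * T -> R) (y : Omega -> T) : past0 k `<=` p -> bmeas c F ->
  measurable_fun [set: g_sigma_algebraType p] y ->
  bmeas c (fun w : g_sigma_algebraType p => F (theta k w : Z, y w)).
Proof.
move=> pp bF my; apply: (bmeas_comp bF); apply: measurable_fun_pair => //.
exact: (measurable_past_sub pp (@measurable_theta k)).
Qed.

(** Summing over the values t of the horizon, of probability (1 - gamma) gamma^t, turns [F] at the
    last pair into its discounted sum. Keeping an arbitrary [psi] of the iterate inside the integral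
    stands for conditioning on the iterate. *)
Lemma horizon_integral k c cF (psi : Z -> R) (F : Z * (S * A) -> R) :
  bmeas c psi -> bmeas cF F ->
  \int[P]_w (psi (theta k w : Z) * F (theta k w : Z, last_pair k w)) =
  (1 - gamma) * \int[P]_w (psi (theta k w : Z) *
    avg_action pden (resolvent M pden F) (theta k w : Z, s0)).
Proof.
move=> bpsi bF; have [_ /(_ k)[drawT traj _ _ _]] := rpg.
have sub01 : past0 k `<=` past1 k by move=> H; left.
have bpsi0 := bmeas_comp bpsi (@measurable_theta k).
pose u t w := psi (theta k w : Z) * (horizon X k w == t)%:R *
  F (theta k w : Z, (st X k t w, act X k t w)).
(* The horizon is drawn before the trajectory, so the indicator that it equals t is a legitimate
   weight for the trajectory lemma. *)
have bW t : bmeas (c * 1) (fun w : g_sigma_algebraType (past1 k) =>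
    psi (theta k w : Z) * (horizon X k w == t)%:R).
  apply: (bmeasM (bmeas_sub sub01 bpsi0)).
  by apply: (@mhorizon (fun m => m == t)) => H; right.
have bu t : bmeas (c * 1 * cF) (u t).
  apply: (bmeasM (bmeas_past (@past1_measurable k) (bW t))).
  apply: (bmeas_comp bF); apply: measurable_fun_pair.
    exact: (measurable_from_past (@events_before_measurable k) (@measurable_theta k)).
  exact: measurable_fun_pair.
have bG t := avg_action_bmeas pden (iter_avg_step_bmeas M pden t bF).
have bpsiG t : bmeas (c * cF) (fun w : g_sigma_algebraType (past0 k) =>
    psi (theta k w : Z) *
    avg_action pden (iter t (avg_step M pden) F) (theta k w : Z, s0)).
  apply: (bmeasM bpsi0).
  by apply: (bmeas_theta _ (bG t) (measurable_cst s0)).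
have Iu t : \int[P]_w u t w = (1 - gamma) * gamma ^+ t *
    \int[P]_w (psi (theta k w : Z) *
      avg_action pden (iter t (avg_step M pden) F) (theta k w : Z, s0)).
  have mth1 := measurable_past_sub sub01 (@measurable_theta k).
  rewrite (trajectory_from_state_integral pden (@past1_measurable k) mth1 t traj
    (bW t) bF).
  rewrite -(geometric_eq_integral (@events_before_measurable k) gamma01 drawT
    (bpsiG t)).
  by apply: eq_Rintegral => w _; rewrite mulrAC.
(* The horizon is unbounded, so the sum over its values is truncated at m. At a fixed [w] the
   truncation is exact once m exceeds the horizon, and it is uniformly bounded since at most one
   term is nonzero. *)
pose f m w := \sum_(0 <= t < m) 1 * u t w.
have fE m w : f m w = psi (theta k w : Z) * \sum_(0 <= t < m)
    (horizon X k w == t)%:R * F (theta k w : Z, (st X k t w, act X k t w)).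
  by rewrite mulr_sumr; apply: eq_bigr => t _; rewrite mul1r mulrA.
have cF0 : 0 <= cF by case: bF => _ /(_ point); exact: le_trans.
have fb m w : `|f m w| <= c * cF.
  rewrite fE normrM; apply: ler_pM => //; first by case: bpsi.
  have [Nm|mN] := ltnP (horizon X k w) m.
    rewrite (sum_pick (fun t => F (theta k w : Z, (st X k t w, act X k t w))) Nm).
    by case: bF.
  rewrite (sum_pick_out (fun t => F (theta k w : Z, (st X k t w, act X k t w))) mN).
  by rewrite normr0.
have fcvg w : f m w @[m --> \oo] -->
    psi (theta k w : Z) * F (theta k w : Z, last_pair k w).
  apply: cvg_near_cst; near=> m; rewrite fE; congr (_ * _).
  apply: (sum_pick (fun t => F (theta k w : Z, (st X k t w, act X k t w)))).
  by near: m; exact: nbhs_infty_gt.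
have mf m : measurable_fun setT (f m).
  by have [] := bmeas_sum (index_iota 0 m) (fun=> 1) bu.
have lhs := bounded_Rintegral_cvg P1 mf fb fcvg.
pose g m w := psi (theta k w : Z) *
  avg_action pden (resolvent_sum M pden m F) (theta k w : Z, s0).
have bg m : bmeas (c * (cF / (1 - gamma))) (g m).
  apply: (bmeas_past (@events_before_measurable k)).
  apply: (bmeasM bpsi0).
  exact: (bmeas_theta _ (avg_action_bmeas pden (resolvent_sum_bmeas M pden bF m))
    (measurable_cst s0)).
have gcvg w : g m w @[m --> \oo] --> psi (theta k w : Z) *
    avg_action pden (resolvent M pden F) (theta k w : Z, s0).
  apply: cvgMr.
  apply: (avg_action_cvg (e := cF / (1 - gamma))) => [m|x].
    exact: resolvent_sum_bmeas.
  exact: (resolvent_sum_cvg bF).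
have rhs := bounded_Rintegral_cvg P1 (fun m => (bg m).1) (fun m => (bg m).2) gcvg.
have fg : (fun m => \int[P]_w f m w) = (fun m => (1 - gamma) * \int[P]_w g m w).
  apply/funext => m; rewrite /f (Rintegral_sum _ _ P1 bu).
  under eq_bigr do rewrite mul1r Iu -mulrA.
  rewrite -mulr_sumr; congr (_ * _).
  rewrite -(Rintegral_sum _ _ P1 (fun t =>
    bmeas_past (@events_before_measurable k) (bpsiG t))).
  apply: eq_Rintegral => w _; rewrite /g (avg_action_resolvent_sum M pden bF) mulr_sumr.
  by apply: eq_bigr => t _; rewrite mulrCA.
rewrite fg in lhs; apply: (cvg_unique _ lhs) => //.
by apply: cvgMr; exact: rhs.
Unshelve. all: by end_near. Qed.

(** [h] may depend on all draws up to the first trajectory, hence on the last pair and the score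
    there. The reward at time t counts when T' >= t; since T' is drawn before the fresh trajectory,
    that indicator is again a weight. *)
Lemma Qhat_integral k c (h : Omega -> R) :
  bmeas c (h : g_sigma_algebraType (past2 k) -> R) ->
  \int[P]_w (h w * Qhat M X k w) =
  \int[P]_w (h w * Q (theta k w : Z, last_pair k w)).
Proof.
move=> bh; have [_ /(_ k)[_ _ drawT traj _]] := rpg.
have sub02 : past0 k `<=` past2 k by move=> H; left; left.
have sub03 : past0 k `<=` past3 k by move=> H; left; left; left.
have sub23 : past2 k `<=` past3 k by move=> H; left.
set s := gamma `^ 2^-1.
have br := rewardZ_bmeas Z reward_bounded.
pose r t w := reward M (stQ X k t w, actQ X k t w).
pose u t w := h w * (t <= horizonQ X k w)%N%:R * r t w.
have bW t : bmeas (c * 1) (fun w : g_sigma_algebraType (past3 k) =>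
    h w * (t <= horizonQ X k w)%N%:R).
  apply: (bmeasM (bmeas_sub sub23 bh)).
  by apply: (@mhorizon (fun m => (t <= m)%N)) => H; right.
have bu t : bmeas (c * 1 * U_R) (u t).
  apply: (bmeasM (bmeas_past (@past3_measurable k) (bW t))); split.
    by apply: measurableT_comp => //; exact: measurable_fun_pair.
  by move=> w; exact: reward_bounded.
have mlast : measurable_fun [set: g_sigma_algebraType (past2 k)] (last_pair k).
  by apply: measurable_last_pair => H Hk; [left; right|right].
have bhK t : bmeas (c * U_R) (fun w : g_sigma_algebraType (past2 k) =>
    h w * iter t (avg_step M pden) (@rewardZ _ _ _ _ _ _ M Z)
      (theta k w : Z, last_pair k w)).
  apply: (bmeasM bh); apply: (bmeas_theta sub02 _ mlast).
  exact: iter_avg_step_bmeas.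
have Iu t : \int[P]_w u t w = s ^+ t *
    \int[P]_w (h w * iter t (avg_step M pden) (@rewardZ _ _ _ _ _ _ M Z)
      (theta k w : Z, last_pair k w)).
  have mth3 := measurable_past_sub sub03 (@measurable_theta k).
  rewrite -(geometric_ge_integral (@past2_measurable k) sqrt_discount01 drawT (bhK t)).
  have := trajectory_from_pair_integral pden (@past3_measurable k) mth3 t traj
    (bW t) br.
  rewrite /u /r /rewardZ /= => ->.
  by apply: eq_Rintegral => w _; rewrite mulrAC.
(* Truncation again; here the uniform bound comes from the geometric decay of the terms, with ratio
   the square root of [gamma]. *)
pose f m w := \sum_(0 <= t < m) s ^+ t * u t w.
have fE m w : f m w = h w * \sum_(0 <= t < m)
    (t <= horizonQ X k w)%N%:R * (s ^+ t * r t w).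
  by rewrite mulr_sumr; apply: eq_bigr => t _; rewrite /u; ring.
have fb m w : `|f m w| <= c * 1 * U_R / (1 - s).
  apply: (series_geometric_le m sqrt_discount_ge0_lt1) => t.
  have /andP[s_gt0 _] := sqrt_discount01.
  rewrite normrM mulrC (ger0_norm (exprn_ge0 t (ltW s_gt0))).
  by rewrite ler_wpM2r ?exprn_ge0 ?(ltW s_gt0)//; have [_] := bu t.
have fcvg w : f m w @[m --> \oo] --> h w * Qhat M X k w.
  apply: cvg_near_cst; near=> m; rewrite fE; congr (_ * _).
  rewrite (sum_until (fun t => s ^+ t * r t w)).
    by apply: eq_bigr => t _; rewrite powR_half.
  by near: m; exact: nbhs_infty_gt.
have mf m : measurable_fun setT (f m).
  by have [] := bmeas_sum (index_iota 0 m) (fun t => s ^+ t) bu.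
have lhs := bounded_Rintegral_cvg P1 mf fb fcvg.
pose g m w := h w * resolvent_sum M pden m (@rewardZ _ _ _ _ _ _ M Z)
  (theta k w : Z, last_pair k w).
have bg m : bmeas (c * (U_R / (1 - gamma))) (g m).
  apply: (bmeas_past (@past2_measurable k)); apply: (bmeasM bh).
  exact: (bmeas_theta sub02 (resolvent_sum_bmeas M pden br m) mlast).
have gcvg w : g m w @[m --> \oo] --> h w * Q (theta k w : Z, last_pair k w).
  by apply: cvgMr; exact: (resolvent_sum_cvg br).
have rhs := bounded_Rintegral_cvg P1 (fun m => (bg m).1) (fun m => (bg m).2) gcvg.
have fg : (fun m => \int[P]_w f m w) = (fun m => \int[P]_w g m w).
  apply/funext => m; rewrite /f (Rintegral_sum _ _ P1 bu).
  (* One factor comes from the weights of the estimate, the other from the tail of its horizon. *)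
  under eq_bigr do rewrite Iu mulrA sqr_sqrt_discount.
  rewrite -(Rintegral_sum _ _ P1 (fun t =>
    bmeas_past (@past2_measurable k) (bhK t))).
  apply: eq_Rintegral => w _; rewrite /g /resolvent_sum mulr_sumr.
  by apply: eq_bigr => t _; rewrite mulrCA.
rewrite fg in lhs.
by apply: (cvg_unique _ lhs) => //; exact: rhs.
Unshelve. all: by end_near. Qed.

Local Notation G i := (policy_grad M policy_pi pi_differentiable i).

(** The draws are integrated out backwards: first the estimate given the last pair, which leaves Q
    times the score, then the horizon with the first trajectory. The factor [1 - gamma] cancels the
    denominator of the update. *)
Lemma estimator_unbiased k i c (psi : Z -> R) : bmeas c psi ->
  \int[P]_w (psi (theta k w : Z) *
    (Qhat M X k w * score_coord pi_ i (theta k w : Z, last_pair k w))) =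
  (1 - gamma) * \int[P]_w (psi (theta k w : Z) * G i (theta k w : Z, s0)).
Proof.
move=> bpsi.
have bF := score_return_bmeas policy_pi reward_bounded pi_differentiable
  score_exists score_bounded i.
rewrite -(horizon_integral k bpsi bF).
have bscore := score_coord_bmeas policy_pi pi_differentiable score_exists score_bounded i.
have sub02 : past0 k `<=` past2 k by move=> H; left; left.
have mlast : measurable_fun [set: g_sigma_algebraType (past2 k)] (last_pair k).
  by apply: measurable_last_pair => H Hk; [left; right|right].
have bh : bmeas (c * B_Theta) (fun w : g_sigma_algebraType (past2 k) =>
    psi (theta k w : Z) * score_coord pi_ i (theta k w : Z, last_pair k w)).
  apply: bmeasM; last exact: (bmeas_theta sub02 bscore mlast).
  exact: (bmeas_sub sub02 (bmeas_comp bpsi (@measurable_theta k))).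
transitivity (\int[P]_w (psi (theta k w : Z) *
    score_coord pi_ i (theta k w : Z, last_pair k w) * Qhat M X k w)).
  by apply: eq_Rintegral => w _; rewrite -mulrA (mulrC (score_coord _ _ _)).
rewrite (Qhat_integral bh); apply: eq_Rintegral => w _.
by rewrite /score_return -mulrA (mulrC (score_coord _ _ _)).
Qed.

End rpg_expectation.

(** * Expected ascent in one iteration *)

Section rpg_ascent.
Context (R : realType) (n : nat) (dS dA dO : measure_display)
  (S : measurableType dS) (A : measurableType dA)
  (nu : {sigma_finite_measure set A -> \bar R}) (M : mdp R S A)
  (pi_ : 'rV[R]_n -> S -> A -> R).
Hypothesis policy_pi : forall theta, is_policy nu (pi_ theta).
Variables (U_R L_Theta B_Theta : R).
Hypothesis reward_bounded : forall s a, `|reward M (s, a)| <= U_R.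
Hypothesis pi_differentiable : forall s a theta,
  differentiable (fun th => pi_ th s a) theta.
Hypothesis score_exists : forall s a theta, 0 < pi_ theta s a /\
  differentiable (fun th => ln (pi_ th s a)) theta.
Hypothesis score_lipschitz : forall s a theta1 theta2,
  l2norm (score pi_ theta1 s a - score pi_ theta2 s a)
    <= L_Theta * l2norm (theta1 - theta2).
Hypothesis score_bounded : forall s a theta,
  l2norm (score pi_ theta s a) <= B_Theta.
Variables (s0 : S) (theta0 : 'rV[R]_n) (alpha : nat -> R)
  (Omega : measurableType dO) (P : probability Omega R)
  (X : rpg_draws P S A) (theta : nat -> Omega -> 'rV[R]_n).
Hypothesis rpg : is_rpg nu M pi_ s0 alpha theta0 X theta.
Variable alpha_max : R.
Hypothesis alpha_le : forall k, 0 <= alpha k <= alpha_max.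

Local Notation gamma := (discount M).
Local Notation Z := (pspace R n).
Let pden := policy_density policy_pi pi_differentiable.
Local Notation V := (Vfun M pden).
Local Notation q := (U_R / (1 - gamma)).
Local Notation G := (policy_grad M policy_pi pi_differentiable).

Let P1 : P setT = 1%E. Proof. exact: probability_setT. Qed.

Let gamma_lt1 : 0 < 1 - gamma.
Proof. by have /andP[_] := discount01 M; lra. Qed.

Let U0 : 0 <= U_R.
Proof. exact: le_trans (reward_bounded point point). Qed.

Let B0 : 0 <= B_Theta.
Proof. exact: le_trans (l2norm_ge0 _) (score_bounded point point 0). Qed.

Lemma smooth_cst_ge0 D : 0 <= smooth_cst M U_R L_Theta B_Theta D.
Proof.
have q0 : 0 <= q by rewrite divr_ge0// ltW.
rewrite /smooth_cst divr_ge0 ?(ltW gamma_lt1)// addr_ge0//.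
  by rewrite mulr_ge0// addr_ge0// mulr_ge0 ?sqr_ge0 ?expR_ge0.
by rewrite divr_ge0 ?(ltW gamma_lt1)// mulr_ge0 ?sqr_ge0.
Qed.

Let step_cst := Qhat_bound M U_R * B_Theta / (1 - gamma).

(** [step_cst] bounds the length of an update divided by its stepsize, so [alpha_max * step_cst] is
    a cap that no update exceeds; the smoothness constant is taken there. *)
Definition ascent_cst :=
  smooth_cst M U_R L_Theta B_Theta (alpha_max * step_cst) * step_cst ^+ 2.

Lemma ascent_cst_ge0 : 0 <= ascent_cst.
Proof. by rewrite mulr_ge0 ?smooth_cst_ge0 ?sqr_ge0. Qed.

(** The factor 1 gives the sum the shape required by [Rintegral_sum]. *)
Definition grad_sq k : R :=
  \int[P]_w \sum_(i < n) 1 * (G i (theta k w : Z, s0) * G i (theta k w : Z, s0)).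

Definition mean_value k : R := \int[P]_w V (theta k w : Z, s0).

Let mtheta k : measurable_fun [set: Omega] (theta k : Omega -> Z).
Proof.
apply: (measurable_from_past (events_before_measurable (X := X) (k := k))).
exact: (measurable_theta policy_pi pi_differentiable score_exists rpg).
Qed.

Let btheta d' (T : measurableType d') k c (F : Z * T -> R) (y : Omega -> T) :
  bmeas c F -> measurable_fun setT y ->
  bmeas c (fun w => F (theta k w : Z, y w)).
Proof.
move=> bF my; apply: (bmeas_comp bF); exact: measurable_fun_pair.
Qed.

Let bV k : bmeas q (fun w => V (theta k w : Z, s0)).
Proof. exact: (btheta _ (Vfun_bmeas pden reward_bounded) (measurable_cst s0)). Qed.

Let bG := policy_grad_bmeas policy_pi reward_bounded pi_differentiable
  score_exists score_bounded.

Lemma mean_value_le k : `|mean_value k| <= q.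
Proof. by have [mV Vc] := bV k; exact: (normr_Rintegral_le P1). Qed.

Let bGG k i := bmeasM (btheta k (bG i) (measurable_cst s0))
  (btheta k (bG i) (measurable_cst s0)).

Lemma grad_sq_ge0 k : 0 <= grad_sq k.
Proof.
apply: Rintegral_ge0 => w _; apply: sumr_ge0 => i _.
by rewrite mul1r -expr2 sqr_ge0.
Qed.

Lemma expectation_grad_sq k :
  ('E_P[fun w => (l2norm (gradient (fun th : 'rV[R]_n => V (th : Z, s0))
    (theta k w)) ^+ 2)%R] = (grad_sq k)%:E)%E.
Proof.
have [m1 b1] := bmeas_sum (index_enum 'I_n) (fun=> 1) (bGG k).
rewrite unlock /grad_sq (EFin_bounded_Rintegral P1 m1 b1).
apply: eq_integral => w _; congr EFin.
rewrite (gradient_Vfun policy_pi reward_bounded pi_differentiable score_exists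
  score_lipschitz score_bounded) sqr_l2norm.
by apply: eq_bigr => i _; rewrite mxE mul1r expr2.
Qed.

(** The lower half of [Vfun_smooth] holds at every outcome, with v the update. Its linear term
    integrates, by [estimator_unbiased] with a gradient coordinate as weight, to
    [alpha k * grad_sq k]. *)
Lemma rpg_ascent k :
  alpha k * grad_sq k <= mean_value k.+1 - mean_value k + ascent_cst * alpha k ^+ 2.
Proof.
have /andP[a0 amax] := alpha_le k.
have [_ /(_ k)[_ _ _ _ thS]] := rpg.
pose y w := (last_state X k w, last_action X k w).
have my : measurable_fun setT y.
  apply: (measurable_from_past (events_before_measurable (X := X) (k := k.+1))).
  by apply: measurable_last_pair => H Hk; exists k => //=; left; left; [left|right].
have mQ : measurable_fun setT (Qhat M X k).
  apply: (measurable_from_past (events_before_measurable (X := X) (k := k.+1))).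
  by apply: measurable_Qhat => H Hk; exists k => //=; [left; right|right].
have Qc := Qhat_le reward_bounded X k.
have bscore i := score_coord_bmeas policy_pi pi_differentiable score_exists score_bounded i.
pose v w := (alpha k / (1 - gamma) * Qhat M X k w) *:
  score pi_ (theta k w) (last_state X k w) (last_action X k w).
have v_le w : l2norm (v w) <= alpha k * step_cst.
  rewrite l2normZ !normrM normfV (ger0_norm a0) (gtr0_norm gamma_lt1).
  have -> : alpha k / (1 - gamma) * `|Qhat M X k w| *
      l2norm (score pi_ (theta k w) (last_state X k w) (last_action X k w)) =
      alpha k * (`|Qhat M X k w| *
      l2norm (score pi_ (theta k w) (last_state X k w) (last_action X k w)) /
      (1 - gamma)) by ring.
  rewrite ler_wpM2l// ler_pM2r ?invr_gt0// ler_pM ?l2norm_ge0//; exact: Qc.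
pose g i w := G i (theta k w : Z, s0) *
  (Qhat M X k w * score_coord pi_ i (theta k w : Z, y w)).
have bg i : bmeas (q * B_Theta / (1 - gamma) * (Qhat_bound M U_R * B_Theta)) (g i).
  apply: (bmeasM (btheta k (bG i) (measurable_cst s0))).
  by apply: bmeasM; [split|exact: (btheta k (bscore i) my)].
pose c w := \sum_(i < n) (alpha k / (1 - gamma)) * g i w.
have bc := bmeas_sum (index_enum 'I_n) (fun=> alpha k / (1 - gamma)) bg.
have b1 : bmeas 1 (fun _ : Omega => 1 : R) by split => // w; rewrite normr1.
have ptw w : 1 * V (theta k w : Z, s0) + 1 * c w <=
    1 * V (theta k.+1 w : Z, s0) + (ascent_cst * alpha k ^+ 2) * 1.
  have vD : l2norm (v w) <= alpha_max * step_cst.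
    apply: (le_trans (v_le w)); rewrite ler_wpM2r//.
    have Q0 : 0 <= Qhat_bound M U_R by exact: le_trans (Qc w).
    by apply: divr_ge0; [exact: mulr_ge0|exact: ltW].
  have := Vfun_smooth policy_pi reward_bounded pi_differentiable score_exists
    score_lipschitz score_bounded (theta k w) s0 vD.
  rewrite ler_norml -thS => /andP[+ _].
  have -> : \sum_(i < n) v w 0 i * G i (theta k w : Z, s0) = c w.
    apply: eq_bigr => i _; rewrite /v mxE /g.
    rewrite (_ : score_coord pi_ i _ =
      score pi_ (theta k w) (last_state X k w) (last_action X k w) 0 i)//.
    by move: (score _ _ _ _ _ _) (G _ _) (Qhat _ _ _ _) => s1 s2 s3; ring.
  have vv : smooth_cst M U_R L_Theta B_Theta (alpha_max * step_cst) *
      l2norm (v w) ^+ 2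
      <= ascent_cst * alpha k ^+ 2.
    rewrite /ascent_cst -mulrA ler_wpM2l ?smooth_cst_ge0// -exprMn mulrC.
    by rewrite ler_pXn2r ?nnegrE ?l2norm_ge0// (le_trans (l2norm_ge0 (v w))).
  by rewrite -/pden; move: vv; lra.
have L := bmeas_lin 1 1 (bV k) bc.
have Rr := bmeas_lin 1 (ascent_cst * alpha k ^+ 2) (bV k.+1) b1.
have H : 1 * mean_value k + 1 * \int[P]_w c w <=
    1 * mean_value k.+1 + (ascent_cst * alpha k ^+ 2) * 1.
  have I1 : \int[P]_w (1 : R) = 1.
    by rewrite Rintegral_cst// [X in fine X]probability_setT mulr1.
  have := le_bounded_Rintegral P1 L.1 L.2 Rr.1 Rr.2 ptw.
  rewrite (Rintegral_lin P1 _ _ (bV k).1 (bV k).2 bc.1 bc.2).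
  by rewrite (Rintegral_lin P1 _ _ (bV k.+1).1 (bV k.+1).2 b1.1 b1.2) I1.
have Ec : \int[P]_w c w = alpha k * grad_sq k.
  rewrite /c (Rintegral_sum _ _ P1 bg).
  rewrite /grad_sq (Rintegral_sum _ _ P1 (bGG k)) mulr_sumr.
  apply: eq_bigr => i _.
  have bpsi : bmeas (q * B_Theta / (1 - gamma)) (fun th : Z => G i (th, s0)).
    exact: (bmeas_comp (bG i) (measurable_pair2 s0)).
  rewrite (estimator_unbiased policy_pi reward_bounded pi_differentiable
    score_exists score_bounded rpg k i bpsi).
  move: (\int[P]_w _) => I0.
  by rewrite mul1r mulrA divfK// gt_eqF.
move: H; rewrite Ec.
by move: (mean_value k) (mean_value k.+1) (grad_sq k) ascent_cst => *; lra.
Qed.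

End rpg_ascent.

(** * Rates *)

Section rates.
Context (R : realType).

Lemma rate_exponent_gt0 (a : R) : 0 < a < 1 -> 0 < rate_exponent a.
Proof. by move=> /andP[a0 a1]; rewrite /rate_exponent lt_min subr_gt0 a1. Qed.

(* Averaging over the window [k, 2k) instead of [0, k) makes the sum of the
   squared steps of order k^(1 - 2a) also when a = 1/2, without a logarithm. *)
Lemma window_rate (g e : nat -> R) (a q C : R) : 0 < a < 1 ->
  (forall k, 0 <= g k) -> (forall k, `|e k| <= q) -> 0 <= C ->
  (forall k, (0 < k)%N ->
    k%:R `^ (- a) * g k <= e k.+1 - e k + C * (k%:R `^ (- a)) ^+ 2) ->
  forall k, (0 < k)%N -> exists m, (m < k + k)%N /\
    g m <= (2 * (2 * q + C) + 1) * k%:R `^ (- rate_exponent a).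
Proof.
move=> a01 g0 eq C0 H k k0; have /andP[a0 a1] := a01.
set B := 2 * (2 * q + C) + 1; set y := k%:R `^ _.
have q0 : 0 <= q by exact: le_trans (eq 0%N).
have k1 : 1 <= k%:R :> R by rewrite ler1n.
have kR : 0 < k%:R :> R by rewrite ltr0n.
pose x : R := k%:R `^ (- a).
have x0 : 0 < x by exact: powR_gt0.
have y0 : 0 < y by exact: powR_gt0.
(* The two arguments of the minimum enter separately: the exponent is at most a here, and at most 1
   - a in [kxy]. *)
have xy : x <= y.
  by apply: ler_powR => //; rewrite lerN2 /rate_exponent ge_min lexx orbT.
have kxy : 1 <= k%:R * x * y.
  have nz (r : R) : (r == 0) ==> (k%:R != 0 :> R) by rewrite (gt_eqF kR) implybT.
  rewrite /x /y -{1}(powRr1 (ltW kR)) -!powRD//.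
  rewrite -[leLHS](powRr0 k%:R); apply: ler_powR => //.
  by have : rate_exponent a <= 1 - a; [rewrite /rate_exponent ge_min lexx|lra].
have pw (m : nat) : (k <= m)%N -> m%:R `^ (- a) <= x.
  move=> km; have m0 : 0 < m%:R :> R by rewrite ltr0n (leq_trans k0).
  rewrite /x !powRN lef_pV2 ?posrE ?powR_gt0//.
  by apply: ge0_ler_powR; rewrite ?nnegrE ?ler_nat// ltW.
(* Within the window the steps at most halve, as (2k)^(-a) = 2^(-a) k^(-a) and a < 1. *)
have pw2 (m : nat) : (0 < m < k + k)%N -> x / 2 <= m%:R `^ (- a).
  move=> /andP[m0 mk]; have m0' : 0 < m%:R :> R by rewrite ltr0n.
  apply: (@le_trans _ _ ((k + k)%:R `^ (- a))); last first.
    rewrite !powRN lef_pV2 ?posrE ?powR_gt0 ?ltr0n ?addn_gt0 ?k0//.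
    apply: ge0_ler_powR; rewrite ?nnegrE ?ler_nat ?(ltW a0) ?(ltnW mk) ?ler0n//.
  have -> : (k + k)%:R = 2 * k%:R :> R by rewrite natrD; ring.
  rewrite powRM// mulrC ler_pM2r//.
  have -> : 2^-1 = 2 `^ (-1) :> R by rewrite powR_inv1.
  by apply: ler_powR; [lra|rewrite lerN2 ltW].
(* If all terms below 2k exceeded [B * y], the ascent inequality summed over the window would give k
   (x/2) B y <= 2q + C k x^2. By 1 <= k x y and x <= y the right side is at most (2q + C) k x y, so
   B/2 <= 2q + C, which the summand 1 in [B] excludes. *)
apply: contrapT => noM.
have gm m : (m < k + k)%N -> B * y < g m.
  move=> mk; rewrite ltNge; apply/negP => gle.
  by apply: noM; exists m.
have lo : \sum_(k <= m < k + k) (x / 2 * (B * y)) <=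
    \sum_(k <= m < k + k) m%:R `^ (- a) * g m.
  rewrite big_nat [leRHS]big_nat; apply: ler_sum => m /andP[km mk].
  apply: ler_pM => //.
  - by rewrite divr_ge0 ?ltW.
  - by rewrite mulr_ge0 ?(ltW y0)// /B; lra.
  - by apply: pw2; rewrite mk (leq_trans k0).
  - exact/ltW/gm.
have up : \sum_(k <= m < k + k) m%:R `^ (- a) * g m <=
    \sum_(k <= m < k + k) ((e m.+1 - e m) + C * x ^+ 2).
  rewrite big_nat [leRHS]big_nat; apply: ler_sum => m /andP[km mk].
  apply: (le_trans (H m (leq_trans k0 km))); rewrite lerD2l ler_wpM2l//.
  by rewrite ler_pXn2r ?nnegrE ?powR_ge0 ?pw// ltW.
have := le_trans lo up.
rewrite big_split /= telescope_sumr ?leq_addr// !sumr_const_nat addnK.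
rewrite -[X in X <= _]mulr_natl -[X in _ <= _ + X]mulr_natl.
have e1 := eq (k + k)%N; have e2 := eq k.
have {e1 e2} : e (k + k)%N - e k <= 2 * q.
  by move: e1 e2; rewrite !ler_norml => /andP[_ +] /andP[+ _]; lra.
move=> h1 h2.
have h3 : 2 * q <= 2 * q * (k%:R * x * y) by rewrite ler_peMr// mulr_ge0.
have h4 : C * (k%:R * x) * x <= C * (k%:R * x) * y.
  by rewrite ler_wpM2l// !mulr_ge0// ltW.
have h5 : k%:R * (x / 2 * (B * y)) <= (2 * q + C) * (k%:R * x * y).
  apply: (le_trans h2).
  apply: (@le_trans _ _ (2 * q + C * (k%:R * x) * x)).
    by rewrite lerD// le_eqVlt; apply/orP; left; apply/eqP; ring.
  rewrite [leRHS]mulrDl lerD// (le_trans h4)// le_eqVlt.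
  by apply/orP; left; apply/eqP; ring.
have : B / 2 <= 2 * q + C.
  rewrite -(ler_pM2r (lt_le_trans ltr01 kxy)); apply: le_trans h5.
  by rewrite le_eqVlt; apply/orP; left; apply/eqP; field.
by rewrite /B; lra.
Qed.

Lemma first_below_rate (E : nat -> \bar R) (g : nat -> R) (B p : R) :
  0 < B -> 0 < p -> (forall m, E m = (g m)%:E) ->
  (forall k, (0 < k)%N ->
    exists m, (m < k + k)%N /\ g m <= B * k%:R `^ (- p)) ->
  exists K : R -> nat, (forall eps, 0 < eps -> is_first_below E eps (K eps)) /\
    (forall eps, 0 < eps <= 1 ->
      (K eps)%:R <= (2 * B `^ p^-1 + 2) * eps `^ (- p^-1)).
Proof.
move=> B0 p0 EE H.
pose ok eps j := (ereal_inf [set E m | m in [set m | (m <= j)%N]] <= eps%:E)%E.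
(* [r eps] solves B r^(-p) = eps; the first integer above it serves as window length, and twice that
   integer bounds the first index. *)
pose r eps := (B / eps) `^ p^-1.
pose k eps := (Num.truncn (r eps)).+1.
have okk eps : 0 < eps -> ok eps (k eps + k eps)%N.
  move=> e0; have [m [mk gm]] := H (k eps) isT.
  apply: (@le_trans _ _ (E m)).
    by apply: ereal_inf_lbound; exists m => //=; exact: ltnW.
  rewrite EE lee_fin (le_trans gm)// powRN ler_pdivrMr ?powR_gt0//.
  rewrite mulrC -ler_pdivrMr//.
  have -> : B / eps = r eps `^ p.
    by rewrite /r -powRrM mulVf ?gt_eqF// powRr1// divr_ge0 ?ltW.
  apply: ge0_ler_powR; rewrite ?nnegrE ?powR_ge0 ?(ltW p0)//.
  by rewrite ltW// truncnS_gt.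
(* For [eps <= 0] a default value 0 is taken, so that [choice] yields a total function. *)
have ex eps : exists j, 0 < eps -> is_first_below E eps j.
  have [e0|_] := boolP (0 < eps); last by exists 0%N.
  have exok : exists j, `[< ok eps j >] by exists (k eps + k eps)%N; apply/asboolP/okk.
  case: (ex_minnP exok) => j /asboolP okj minj.
  by exists j => _; split => // i oki; apply: minj; apply/asboolP.
have [K HK] := choice ex; exists K; split => // eps /andP[e0 e1].
have [_ /(_ _ (okk _ e0)) Kk] := HK eps e0.
have r0 : 0 <= r eps by exact: powR_ge0.
apply: (@le_trans _ _ (k eps + k eps)%N%:R); first by rewrite ler_nat.
have kr : (k eps)%:R <= r eps + 1.
  by rewrite /k -natr1 lerD2r truncn_le.
have rE : r eps = B `^ p^-1 * eps `^ (- p^-1).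
  rewrite /r powRM ?invr_ge0 ?ltW//; congr (_ * _).
  have -> : eps^-1 = eps `^ (-1) by rewrite powR_inv1// ltW.
  by rewrite -powRrM mulN1r.
(* Here [eps <= 1] matters: the additive 2 left by rounding is absorbed into the power. *)
have eps1 : 1 <= eps `^ (- p^-1).
  rewrite powRN invf_ge1 ?powR_gt0//.
  have -> : 1 = 1 `^ p^-1 :> R by rewrite powR1.
  by apply: ge0_ler_powR; rewrite ?nnegrE ?invr_ge0 ?(ltW p0) ?(ltW e0).
rewrite natrD; move: kr; rewrite rE => kr.
by move: (B `^ p^-1) (eps `^ (- p^-1)) eps1 kr => u v; lra.
Qed.

Lemma rate_exponent_half : rate_exponent (2^-1 : R) = 2^-1.
Proof. by rewrite /rate_exponent (_ : 1 - 2^-1 = 2^-1) ?minxx//; field. Qed.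

(** The two arguments of the minimum add up to 1, so it is at most 1/2, and equality forces both to
    be 1/2. *)
Lemma rate_exponent_optimal (b : R) : 0 < b < 1 ->
  (rate_exponent (2^-1 : R))^-1 <= (rate_exponent b)^-1 ?= iff (b == 2^-1).
Proof.
move=> b01; have r0 := rate_exponent_gt0 b01.
have rb : rate_exponent b <= 2^-1.
  rewrite /rate_exponent ge_min; have [|] := leP b 2^-1; first by rewrite orbT.
  by move=> hb; rewrite orbF; lra.
rewrite rate_exponent_half; split; first by rewrite lef_pV2 ?posrE ?invr_gt0.
apply/eqP/eqP => [h|->]; last by rewrite rate_exponent_half.
have {}h : rate_exponent b = 2^-1 by rewrite -[LHS]invrK -h invrK.
move: h; rewrite /rate_exponent; have /andP[b0 b1] := b01.
by case: leP => h1 h2; lra.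
Qed.

Lemma stepsize_bounds (alpha0 a : R) k : 0 < alpha0 -> 0 < a < 1 ->
  0 <= stepsize alpha0 a k <= Num.max alpha0 1.
Proof.
move=> al0 /andP[a0 a1]; case: k => [|k] /=; first by rewrite ltW//= le_max lexx.
rewrite powR_ge0 /= le_max; apply/orP; right.
by rewrite -[leRHS](powRr0 k.+1%:R); apply: ler_powR; rewrite ?ler1n// oppr_le0 ltW.
Qed.

Lemma eqO_at_right0 (f g : R -> R) c :
  (forall eps, 0 < eps <= 1 -> `|f eps| <= c * `|g eps|) -> f =O_ (0^'+) g.
Proof.
move=> fg; apply/eqO_exP; exists (`|c| + 1); first by rewrite ltr_wpDl.
near=> eps; apply: (@le_trans _ _ (c * `|g eps|)).
  apply: fg; apply/andP; split; first by near: eps; exact: nbhs_right_gt.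
  by near: eps; exact: nbhs_right_le.
by rewrite ler_wpM2r// (le_trans (ler_norm c))// lerDl.
Unshelve. all: by end_near. Qed.

End rates.

Theorem theorem4p3 (R : realType) (dS dA dO : measure_display)
    (S : measurableType dS) (A : measurableType dA)
    (nu : {sigma_finite_measure set A -> \bar R}) (M : mdp R S A)
    (n : nat) (pi_ : 'rV[R]_n -> S -> A -> R)
    (policy_pi : forall theta, is_policy nu (pi_ theta))
    (V : 'rV[R]_n -> S -> R)
    (value_V : forall theta s, is_value nu M (pi_ theta) s (V theta s))
    (U_R L_Theta B_Theta : R)
    (reward_bounded : forall s a, `|reward M (s, a)| <= U_R)
    (pi_differentiable : forall s a theta,
      differentiable (fun th => pi_ th s a) theta)
    (score_exists : forall s a theta, 0 < pi_ theta s a /\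
      differentiable (fun th => ln (pi_ th s a)) theta)
    (score_lipschitz : forall s a theta1 theta2,
      l2norm (score pi_ theta1 s a - score pi_ theta2 s a)
        <= L_Theta * l2norm (theta1 - theta2))
    (score_bounded : forall s a theta,
      l2norm (score pi_ theta s a) <= B_Theta)
    (s0 : S) (theta0 : 'rV[R]_n)
    (alpha0 a : R) (alpha0_gt0 : 0 < alpha0) (a01 : 0 < a < 1)
    (Omega : measurableType dO) (P : probability Omega R)
    (X : rpg_draws P S A) (theta : nat -> Omega -> 'rV[R]_n)
    (rpg_theta : is_rpg nu M pi_ s0 (stepsize alpha0 a) theta0 X theta) :
  let gradJ := gradient (fun th => V th s0) in
  let EgradJ2 (m : nat) := 'E_P[fun w => (l2norm (gradJ (theta m w)) ^+ 2)%R]%E in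
  (exists K : R -> nat,
    [/\ forall eps, 0 < eps -> is_first_below EgradJ2 eps (K eps),
        (fun eps => (K eps)%:R : R) =O_ (0^'+)
          (fun eps => eps `^ (- (rate_exponent a)^-1)) &
        a = 2^-1 ->
        (fun eps => (K eps)%:R : R) =O_ (0^'+) (fun eps => eps ^- 2)])
  /\ (forall b : R, 0 < b < 1 ->
       (rate_exponent (2^-1 : R))^-1 <= (rate_exponent b)^-1
         ?= iff (b == 2^-1)).
Proof.
move=> gradJ EgradJ2; split; last exact: rate_exponent_optimal.
pose pden := policy_density policy_pi pi_differentiable.
(* [V] is known only through [value_V]. It has to be identified as a function of the parameter, and
   not only at the iterates, for the gradients to agree. *)
have VE : (fun th => V th s0) =
    (fun th : 'rV[R]_n => Vfun M pden (th : pspace R n, s0)).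
  apply/funext => th.
  exact: (is_valueE pden (z := (th : pspace R n)) reward_bounded (value_V th s0)).
have alpha_le k := stepsize_bounds k alpha0_gt0 a01.
pose g := grad_sq M policy_pi pi_differentiable s0 P theta.
pose C := ascent_cst M U_R L_Theta B_Theta (Num.max alpha0 1).
pose q := U_R / (1 - discount M).
have C0 : 0 <= C by exact: ascent_cst_ge0.
have e_le := mean_value_le policy_pi reward_bounded pi_differentiable
  score_exists rpg_theta.
have g_ge0 := grad_sq_ge0 M policy_pi pi_differentiable s0 P theta.
have ascent := rpg_ascent policy_pi reward_bounded pi_differentiable
  score_exists score_lipschitz score_bounded rpg_theta alpha_le.
have EE m : EgradJ2 m = (g m)%:E.
  rewrite /EgradJ2 /gradJ VE.
  exact: (expectation_grad_sq policy_pi reward_bounded pi_differentiable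
    score_exists score_lipschitz score_bounded rpg_theta).
have rate := window_rate a01 g_ge0 e_le C0.
have B_gt0 : 0 < 2 * (2 * q + C) + 1.
  have q0 : 0 <= q by exact: le_trans (e_le 0%N).
  by lra.
have [|K [Kfirst Kle]] := first_below_rate B_gt0 (rate_exponent_gt0 a01) EE.
  apply: rate => k k0.
  (* The window begins at k >= 1, where the stepsize is the power; [alpha0] enters only through the
     constant [C]. *)
  have stepE : stepsize alpha0 a k = k%:R `^ (- a) by case: k k0.
  by have := ascent k; rewrite stepE.
set c := 2 * _ + 2 in Kle.
have Kle' eps : 0 < eps <= 1 ->
    `|(K eps)%:R : R| <= c * `|eps `^ (- (rate_exponent a)^-1)|.
  by move=> eps01; rewrite ger0_norm// ger0_norm ?powR_ge0//; exact: Kle.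
exists K; split => //.
  exact: (eqO_at_right0 Kle').
move=> a_half; apply: (@eqO_at_right0 _ _ _ c) => eps eps01.
have /andP[eps0 _] := eps01.
have -> : eps ^- 2 = eps `^ (- (rate_exponent a)^-1).
  by rewrite a_half rate_exponent_half invrK powRN powR_mulrn// ltW.
exact: Kle'.
Qed.
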